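(* Let $u_1,\dots,u_4$ be a positive orthonormal basis of an oriented Euclidean four-space $\mathcal{T}$. Given $\mu_1,\mu_2,\mu_3,\mu_4,c_2,c_3,c_4\in\mathbb{R}$ with $\mu_1+\mu_2+\mu_3+\mu_4=c_2+c_3+c_4=0$, let $R$ be the algebraic curvature tensor in $\mathcal{T}$ with scalar curvature $\mathrm{s}=0$, with Einstein tensor $\mathrm{e}$ diagonalized by $u_1,u_2,u_3,u_4$ with the respective eigenvalues $\mu_1,\mu_2,\mu_3,\mu_4$, and such that, for each sign $\pm$, $W^\pm:\Lambda^\pm\to\Lambda^\pm$ is diagonalized by the basis $u_1\wedge u_2\pm u_3\wedge u_4,\ u_1\wedge u_3\pm u_4\wedge u_2,\ u_1\wedge u_4\pm u_2\wedge u_3$ of $\Lambda^\pm$ with the respective eigenvalues $\pm c_2,\pm c_3,\pm c_4$. Then: (a) $R$ is weakly Einstein. (b) The only possibly-nonzero components of $W$ in the frame $u_1,\dots,u_4$ are those algebraically related to $W_{1234},W_{1342},W_{1423}$, where $(W_{1234},W_{1342},W_{1423})=(c_2,c_3,c_4)$. (c) For every non-Einstein, weakly Einstein algebraic curvature tensor in an oriented Euclidean four-space, having zero scalar curvature, unless its Einstein tensor $\mathrm{e}$ has two double eigenvalues (that is, two distinct eigenvalues, each of multiplicity two), there exist a positive orthonormal basis $u_1,\dots,u_4$ of the four-space and $\mu_1,\mu_2,\mu_3,\mu_4,c_2,c_3,c_4\in\mathbb{R}$ with $\mu_1+\mu_2+\mu_3+\mu_4=c_2+c_3+c_4=0$ such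 that its Einstein tensor $\mathrm{e}$ is diagonalized by $u_1,u_2,u_3,u_4$ with the respective eigenvalues $\mu_1,\mu_2,\mu_3,\mu_4$ and, for each sign $\pm$, its $W^\pm:\Lambda^\pm\to\Lambda^\pm$ is diagonalized by the basis $u_1\wedge u_2\pm u_3\wedge u_4,\ u_1\wedge u_3\pm u_4\wedge u_2,\ u_1\wedge u_4\pm u_2\wedge u_3$ of $\Lambda^\pm$ with the respective eigenvalues $\pm c_2,\pm c_3,\pm c_4$.
   Context: $\mathcal{T}$ is an oriented Euclidean four-space with inner product $\mathrm{g}$. An algebraic curvature tensor $R$ in $\mathcal{T}$ is a $(0,4)$ tensor with $R_{ijkl}=-R_{jikl}=-R_{ijlk}=R_{klij}$ and $R_{ijkl}+R_{jkil}+R_{kijl}=0$. In an orthonormal basis, the Ricci tensor is $\mathrm{r}_{ij}=\sum_k R_{ikjk}$, the scalar curvature is $\mathrm{s}=\sum_i \mathrm{r}_{ii}$, the Einstein (traceless Ricci) tensor is $\mathrm{e}=\mathrm{r}-\mathrm{s}\,\mathrm{g}/4$, and the Weyl component is $W_{ijkl}=R_{ijkl}-\frac12(\mathrm{g}_{ik}\mathrm{r}_{jl}+\mathrm{g}_{jl}\mathrm{r}_{ik}-\mathrm{g}_{il}\mathrm{r}_{jk}-\mathrm{g}_{jk}\mathrm{r}_{il})+\frac{\mathrm{s}}6(\mathrm{g}_{ik}\mathrm{g}_{jl}-\mathrm{g}_{il}\mathrm{g}_{jk})$. $R$ is called weakly Einstein if the symmetric tensor with components $\sum_{k,p,q}R_{ikpq}R_{jkpq}$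 (in an orthonormal basis) is a multiple of $\mathrm{g}$, and Einstein if $\mathrm{e}=0$. Eigenvalues of $\mathrm{e}$ are taken relative to $\mathrm{g}$. $\Lambda^\pm\subset\mathcal{T}^{\wedge2}$ are the three-dimensional spaces of self-dual and anti-self-dual bivectors; $W$ acts on bivectors $b$ by $[Wb]_{ij}=\sum_{p,q}W_{ipjq}b_{pq}=\frac12\sum_{p,q}W_{ijpq}b_{pq}$, this action preserves $\Lambda^\pm$, and $W^\pm:\Lambda^\pm\to\Lambda^\pm$ denote its restrictions. By the Singer-Thorpe theorem, prescribing $\mathrm{s}\in\mathbb{R}$, a $\mathrm{g}$-traceless symmetric tensor $\mathrm{e}$ and traceless self-adjoint $W^\pm:\Lambda^\pm\to\Lambda^\pm$ defines a unique algebraic curvature tensor $R$. Components of $W$ ''algebraically related'' to given ones are those obtained from them via the symmetries $W_{ijkl}=-W_{jikl}=-W_{ijlk}=W_{klij}$. *)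

(* Defs.v *)
From HB Require Import structures.
From mathcomp Require Import all_boot all_order all_algebra.
From mathcomp Require Import reals.

Set Implicit Arguments.
Unset Strict Implicit.
Unset Printing Implicit Defensive.

Import Order.TTheory GRing.Theory Num.Theory.
Local Open Scope ring_scope.

(* A Euclidean four-space is a vector space T with an inner product g admitting
   an orthonormal basis of four vectors.  Its orientation is represented by one
   such basis o, declared positive; contractions and the volume form are computed
   in o, and do not depend on its choice (contraction_indep, scal_indep,
   einstein_tensor_indep, weyl_indep, weakly_einstein_indep, volume_indep).
   The indices 1, 2, 3, 4 of the literature are 0, 1, 2, 3 here. *)

Section EuclideanFourSpace.
Variables (R : realType) (T : vectType R) (g : {dot T for idfun}).

Definition orthonormal_basis (u : 4.-tuple T) : Prop :=
  basis_of fullv u /\ orthonormal g u.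

Definition tensor2 := T -> T -> R.
Definition tensor4 := T -> T -> T -> T -> R.

Record algebraic_curvature_tensor (F : tensor4) : Prop := {
  act_linear1 : forall y z w, scalar (fun x => F x y z w);
  act_linear2 : forall x z w, scalar (fun y => F x y z w);
  act_linear3 : forall x y w, scalar (fun z => F x y z w);
  act_linear4 : forall x y z, scalar (fun w => F x y z w);
  act_skew12 : forall x y z w, F x y z w = - F y x z w;
  act_skew34 : forall x y z w, F x y z w = - F x y w z;
  act_pair : forall x y z w, F x y z w = F z w x y;
  act_bianchi : forall x y z w, F x y z w + F y z x w + F z x y w = 0 }.

(* Bivectors are identified, through g, with skew-symmetric bilinear forms. *)
Record bivector (b : tensor2) : Prop := {
  biv_linear1 : forall y, scalar (fun x => b x y);
  biv_linear2 : forall x, scalar (fun y => b x y);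
  biv_skew : forall x y, b x y = - b y x }.

Definition wedge (v w : T) : tensor2 :=
  fun x y => g v x * g w y - g v y * g w x.

(* e u_i = mu_i u_i, with the (0,2) tensor e read as an operator through g. *)
Definition diagonalized_by (e : tensor2) (u : 4.-tuple T) (mu : 4.-tuple R) :
    Prop :=
  forall (i : 'I_4) (x : T), e u`_i x = mu`_i * g u`_i x.

Definition eigenvalue_of_multiplicity (e : tensor2) (a : R) (m : nat) : Prop :=
  exists E : {vspace T},
    (forall x, x \in E <-> forall y, e x y = a * g x y) /\ \dim E = m.

Definition two_double_eigenvalues (e : tensor2) : Prop :=
  exists a b : R, a != b /\
    eigenvalue_of_multiplicity e a 2 /\ eigenvalue_of_multiplicity e b 2.

Section Frame.
Variable o : 4.-tuple T.

Definition volume (x y z w : T) : R :=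
  \det (\matrix_(i < 4, j < 4) g [:: x; y; z; w]`_i o`_j).

Definition positive_orthonormal_basis (u : 4.-tuple T) : Prop :=
  orthonormal_basis u /\ 0 < volume u`_0 u`_1 u`_2 u`_3.

Definition ricci (F : tensor4) : tensor2 :=
  fun x y => \sum_(k < 4) F x o`_k y o`_k.

Definition scal (F : tensor4) : R := \sum_(i < 4) ricci F o`_i o`_i.

Definition einstein_tensor (F : tensor4) : tensor2 :=
  fun x y => ricci F x y - scal F * g x y / 4.

Definition weyl (F : tensor4) : tensor4 :=
  let r := ricci F in
  fun x y z w =>
    F x y z w
    - (g x z * r y w + g y w * r x z - g x w * r y z - g y z * r x w) / 2
    + scal F / 6 * (g x z * g y w - g x w * g y z).

Definition einstein (F : tensor4) : Prop :=
  forall x y, einstein_tensor F x y = 0.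

Definition weakly_einstein (F : tensor4) : Prop :=
  exists a : R, forall x y,
    \sum_(k < 4) \sum_(p < 4) \sum_(q < 4)
      F x o`_k o`_p o`_q * F y o`_k o`_p o`_q = a * g x y.

Definition weyl_action (F : tensor4) (b : tensor2) : tensor2 :=
  fun x y => \sum_(p < 4) \sum_(q < 4) weyl F x o`_p y o`_q * b o`_p o`_q.

Definition hodge (b : tensor2) : tensor2 :=
  fun x y =>
    (\sum_(k < 4) \sum_(l < 4) volume x y o`_k o`_l * b o`_k o`_l) / 2.

(* The sign +/- is encoded as (-1) ^+ s with s : bool: Lambda^+ is
   Lambda false, and Lambda^- is Lambda true. *)
Definition Lambda (s : bool) (b : tensor2) : Prop :=
  bivector b /\ forall x y, hodge b x y = (-1) ^+ s * b x y.

Definition Lambda_basis (s : bool) (b : 'I_3 -> tensor2) : Prop :=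
  (forall i, Lambda s (b i)) /\
  forall w, Lambda s w ->
    exists! a : {ffun 'I_3 -> R},
      forall x y, w x y = \sum_(i < 3) a i * b i x y.

Definition weyl_diagonalized_by
    (F : tensor4) (s : bool) (b : 'I_3 -> tensor2) (c : 3.-tuple R) : Prop :=
  Lambda_basis s b /\
  forall (i : 'I_3) x y, weyl_action F (b i) x y = c`_i * b i x y.

End Frame.

Definition Lambda_frame (s : bool) (u : 4.-tuple T) (i : 'I_3) : tensor2 :=
  fun x y =>
    let e := (-1) ^+ s in
    [:: wedge u`_0 u`_1 x y + e * wedge u`_2 u`_3 x y;
        wedge u`_0 u`_2 x y + e * wedge u`_3 u`_1 x y;
        wedge u`_0 u`_3 x y + e * wedge u`_1 u`_2 x y]`_i.

Definition has_spectral_form (o : 4.-tuple T) (F : tensor4) (u : 4.-tuple T)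
    (mu1 mu2 mu3 mu4 c2 c3 c4 : R) : Prop :=
  diagonalized_by (einstein_tensor o F) u [tuple mu1; mu2; mu3; mu4] /\
  forall s : bool,
    weyl_diagonalized_by o F s (Lambda_frame s u)
      [tuple (-1) ^+ s * c2; (-1) ^+ s * c3; (-1) ^+ s * c4].

End EuclideanFourSpace.

Definition index4 : Type := 'I_4 * 'I_4 * 'I_4 * 'I_4.

Inductive algebraically_related : index4 -> index4 -> Prop :=
| alg_refl I : algebraically_related I I
| alg_skew12 i j k l I :
    algebraically_related (j, i, k, l) I -> algebraically_related (i, j, k, l) I
| alg_skew34 i j k l I :
    algebraically_related (i, j, l, k) I -> algebraically_related (i, j, k, l) I
| alg_pair i j k l I :
    algebraically_related (k, l, i, j) I -> algebraically_related (i, j, k, l) I.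

Section FrameIndependence.
Variables (R : realType) (T : vectType R) (g : {dot T for idfun}).
Implicit Types (o u : 4.-tuple T) (B : tensor2 T) (F : tensor4 T).

Lemma dotC (x y : T) : g x y = g y x.
Proof.
have := @hermC R false idfun T g x y.
by rewrite expr0 mul1r.
Qed.

Lemma dot_onb u : orthonormal_basis g u ->
  forall i j : 'I_4, g u`_i u`_j = (i == j)%:R.
Proof.
case=> _; case: u => -[|a [|b [|c [|d [|//]]]]] //= sz.
rewrite /orthonormal /ortho_rec /= !andbT.
move=> /andP[/and4P[/eqP aa /eqP bb /eqP cc /eqP dd]].
case/and3P=> /and3P[/eqP ab /eqP ac /eqP ad] /andP[/eqP bc /eqP bd] /eqP cd.
case=> [[|[|[|[|//]]]] ?] [[|[|[|[|//]]]] ?] //=;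
  by rewrite ?(aa, bb, cc, dd, ab, ac, ad, bc, bd, cd) // dotC
             ?(ab, ac, ad, bc, bd, cd).
Qed.

Lemma onb_expand u x : orthonormal_basis g u ->
  x = \sum_(i < 4) g x u`_i *: u`_i.
Proof.
move=> hu; have [/coord_basis E _] := hu.
rewrite {1}(E x (memvf x)); apply: eq_bigr => i _; congr (_ *: _).
rewrite {2}(E x (memvf x)) linear_sumlz (bigD1 i) //= big1 ?addr0.
  by rewrite linearZl_LR /= dot_onb // eqxx mulr1.
by move=> j /negPf ji; rewrite linearZl_LR /= dot_onb // ji mulr0.
Qed.

Lemma parseval o x y : orthonormal_basis g o ->
  \sum_(i < 4) g o`_i x * g o`_i y = g x y.
Proof.
move=> ho; rewrite [in RHS](onb_expand x ho) linear_sumlz.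
by apply: eq_bigr => i _; rewrite linearZl_LR /= (dotC x).
Qed.

Lemma scalar_sum (f : T -> R) (a : 'I_4 -> R) (v : 'I_4 -> T) :
  scalar f -> f (\sum_(i < 4) a i *: v i) = \sum_(i < 4) a i * f (v i).
Proof.
move=> lf; elim/big_rec2: _ => [|i y1 y2 _ <-]; last exact: lf.
by have := lf (-1) 0 0; rewrite scaler0 addr0 mulN1r addNr.
Qed.

Lemma scalar_sumf n (f : 'I_n -> T -> R) :
  (forall i, scalar (f i)) -> scalar (fun x => \sum_(i < n) f i x).
Proof.
move=> lf a x y; rewrite mulr_sumr -big_split.
by apply: eq_bigr => i _; apply: lf.
Qed.

Lemma scalar_mull (f : T -> R) c : scalar f -> scalar (fun x => c * f x).
Proof. by move=> lf a x y; rewrite lf mulrDr mulrCA. Qed.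

Lemma scalar_mulr (f : T -> R) c : scalar f -> scalar (fun x => f x * c).
Proof. by move=> lf a x y; rewrite lf mulrDl mulrA. Qed.

Lemma contraction_indep o u B :
  orthonormal_basis g o -> orthonormal_basis g u ->
  (forall y, scalar (fun x => B x y)) -> (forall x, scalar (fun y => B x y)) ->
  \sum_(i < 4) B o`_i o`_i = \sum_(i < 4) B u`_i u`_i.
Proof.
move=> ho hu l1 l2.
have E (i : 'I_4) : B o`_i o`_i =
    \sum_(j < 4) \sum_(k < 4) g o`_i u`_j * g o`_i u`_k * B u`_j u`_k.
  rewrite {1}(onb_expand o`_i hu) (scalar_sum _ _ (l1 _)).
  apply: eq_bigr => j _.
  rewrite {2}(onb_expand o`_i hu) (scalar_sum _ _ (l2 _)) mulr_sumr.
  by apply: eq_bigr => k _; rewrite mulrA.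
rewrite (eq_bigr _ (fun i _ => E i)) exchange_big; apply: eq_bigr => j _.
rewrite exchange_big (bigD1 j) //= [X in _ + X]big1 ?addr0 => [|k /negPf kj].
  by rewrite -mulr_suml parseval // dot_onb // eqxx mul1r.
by rewrite -mulr_suml parseval // dot_onb // eq_sym kj mul0r.
Qed.

Lemma ricci_indep o u F : orthonormal_basis g o -> orthonormal_basis g u ->
  algebraic_curvature_tensor F -> ricci o F =2 ricci u F.
Proof.
move=> ho hu hF x y.
apply: (contraction_indep (B := fun a b => F x a y b)) => // z.
  exact: act_linear2.
exact: act_linear4.
Qed.

Lemma scal_indep o u F : orthonormal_basis g o -> orthonormal_basis g u ->
  algebraic_curvature_tensor F -> scal o F = scal u F.
Proof.
move=> ho hu hF; rewrite /scal; under [RHS]eq_bigr do rewrite -(ricci_indep ho hu hF).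
apply: contraction_indep => // z; apply: scalar_sumf => k.
  exact: act_linear1.
exact: act_linear3.
Qed.

Lemma einstein_tensor_indep o u F :
  orthonormal_basis g o -> orthonormal_basis g u ->
  algebraic_curvature_tensor F ->
  einstein_tensor g o F =2 einstein_tensor g u F.
Proof.
by move=> ho hu hF x y; rewrite /einstein_tensor (ricci_indep ho hu) //
  (scal_indep ho hu).
Qed.

Lemma weyl_indep o u F x y z w :
  orthonormal_basis g o -> orthonormal_basis g u ->
  algebraic_curvature_tensor F -> weyl g o F x y z w = weyl g u F x y z w.
Proof.
by move=> ho hu hF; rewrite /weyl !(ricci_indep ho hu) // (scal_indep ho hu).
Qed.

Lemma weakly_einstein_indep o u F :
  orthonormal_basis g o -> orthonormal_basis g u ->
  algebraic_curvature_tensor F ->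
  weakly_einstein g o F -> weakly_einstein g u F.
Proof.
move=> ho hu hF [a Ha]; exists a => x y; rewrite -{}Ha; apply/esym.
case: hF => _ l2 l3 l4 _ _ _ _.
transitivity (\sum_(k < 4) \sum_(p < 4) \sum_(q < 4)
   F x o`_k o`_p u`_q * F y o`_k o`_p u`_q).
  apply: eq_bigr => k _; apply: eq_bigr => p _.
  by apply: (contraction_indep (B := fun a b => F x _ _ a * F y _ _ b)) => //
    z; [apply: scalar_mulr | apply: scalar_mull]; apply: l4.
transitivity (\sum_(k < 4) \sum_(p < 4) \sum_(q < 4)
   F x o`_k u`_p u`_q * F y o`_k u`_p u`_q).
  apply: eq_bigr => k _.
  apply: (contraction_indep
    (B := fun a b => \sum_(q < 4) F x _ a u`_q * F y _ b u`_q)) => //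
    z; apply: scalar_sumf => q;
    [apply: scalar_mulr | apply: scalar_mull]; apply: l3.
apply: (contraction_indep (B := fun a b =>
    \sum_(p < 4) \sum_(q < 4) F x a u`_p u`_q * F y b u`_p u`_q)) => //
    z; do 2![apply: scalar_sumf => ?];
    [apply: scalar_mulr | apply: scalar_mull]; apply: l2.
Qed.

Lemma volume_indep o u x y z w :
  orthonormal_basis g o -> positive_orthonormal_basis g o u ->
  volume g u x y z w = volume g o x y z w.
Proof.
move=> ho [hu].
pose A := \matrix_(i < 4, j < 4) g u`_i o`_j.
have -> : volume g o u`_0 u`_1 u`_2 u`_3 = \det A.
  congr (\det _); apply/matrixP => i j; rewrite !mxE.
  by case: i => [[|[|[|[|//]]]] ?].
move=> Apos.
have AAT : A *m A^T = 1%:M.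
  apply/matrixP => i j; rewrite !mxE -(dot_onb hu) -(parseval _ _ ho).
  by apply: eq_bigr => k _; rewrite !mxE !(dotC _ o`_k).
have detA : \det A = 1.
  have /eqP := congr1 (fun M => \det M) AAT.
  rewrite det_mulmx det_tr det1 -expr2 sqrf_eq1 => /orP[/eqP //|/eqP E].
  by move: Apos; rewrite E oppr_gt0 ltr10.
rewrite -[RHS]mulr1 -detA -(det_tr A) -det_mulmx; congr (\det _).
apply/matrixP => i j; rewrite !mxE -(parseval _ _ ho).
by apply: eq_bigr => k _; rewrite !mxE (dotC u`_j) (dotC o`_k).
Qed.

End FrameIndependence.

(* Main.v *)
Require Import Defs.
From HB Require Import structures.
From mathcomp Require Import all_boot all_order all_algebra.
From mathcomp Require Import reals.
From mathcomp Require Import perm complex ring lra.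

(** In an orthonormal frame [u_0, ..., u_3] diagonalizing the Einstein tensor [e],
    with eigenvalues [mu_i] and zero scalar curvature, the curvature is
    [R = W + (g * e) / 2] for the Kulkarni-Nomizu product [*].  As [W] preserves
    the self-dual and anti-self-dual bivectors while [g * e] exchanges them, the
    trace-free part of the symmetric tensor with components
    [sum_kpq R_ikpq R_jkpq] involves only products of [W] with [e].  Computed in
    components, this says that [R] is weakly Einstein if and only if
    [(mu_i - mu_j) W_ikil = 0] and [(mu_i + mu_j) W_ijij = 0] whenever [i, j, k, l]
    are distinct (lemma [weakly_einsteinP], from [curvature_square_table]).

    Having eigenvalues [c], resp. [- c], on the two halves of the frame of
    bivectors means that [W] sends each [u_i /\ u_j] to [c] times its oriented
    complement ([magneticP]).  Then every component of [W] with a repeated index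
    vanishes, which gives both the shape of [W] and, by the criterion above, the
    weakly Einstein property.

    Conversely, let [R] be weakly Einstein and not Einstein, with zero scalar
    curvature and without two double eigenvalues of [e].  Since the eigenvalues
    of [e] have zero sum and do not all vanish, one of them, say [mu_0], is simple
    ([simple_eigenvalue]).  The criterion then kills the electric part
    [W(u_0, ., u_0, .)] ([electric_part_eq0]), and the rest of it says exactly that
    the magnetic part of [W], a symmetric bilinear form on the orthogonal
    complement of [u_0], commutes with [e] there ([spatial_magnetic_comm]).
    Diagonalizing the two simultaneously by a rotation fixing [u_0]
    ([codiagonalization]) gives the frame of the normal form.  Orientation costs
    nothing: the magnetic form is even in [u_0], whose sign may be changed. *)

Set Implicit Arguments.
Unset Strict Implicit.
Unset Printing Implicit Defensive.

Import Order.TTheory GRing.Theory Num.Theory.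
Local Open Scope ring_scope.

(** * Simultaneous orthogonal diagonalization of commuting symmetric matrices *)

Section Codiagonalization.
Variable R : rcfType.

Lemma mulmx_rV_trE n (x : 'rV[R]_n) : (x *m x^T) 0 0 = \sum_i x 0 i ^+ 2.
Proof. by rewrite mxE; apply: eq_bigr => i _; rewrite mxE expr2. Qed.

Lemma mulmx_rV_tr_ge0 n (x : 'rV[R]_n) : 0 <= (x *m x^T) 0 0.
Proof. by rewrite mulmx_rV_trE sumr_ge0 // => i _; apply: sqr_ge0. Qed.

Lemma mulmx_rV_tr_eq0 n (x : 'rV[R]_n) : (x *m x^T) 0 0 = 0 -> x = 0.
Proof.
move=> /eqP; rewrite mulmx_rV_trE psumr_eq0 => [|i _]; last exact: sqr_ge0.
move=> /allP x0; apply/rowP => i; apply/eqP; rewrite mxE -sqrf_eq0.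
exact: x0 (mem_index_enum i).
Qed.

(** The eigenvalue [a + b i] of a complex eigenvector [x + i y] of a real
    symmetric matrix is real: comparing [x A y^T] with [y A x^T] gives
    [b (|x|^2 + |y|^2) = 0].  Hence [x] and [y] are both real eigenvectors (or
    zero) for the same eigenvalue. *)
Lemma symmetric_complex_eigenvector n (A : 'M[R]_n) (w : 'rV[R[i]]_n) :
    A^T = A -> w != 0 -> stablemx w (map_mx (real_complex R) A) ->
  exists a : R, map_mx (@complex.Re R) w *m A = a *: map_mx (@complex.Re R) w /\
                map_mx (@complex.Im R) w *m A = a *: map_mx (@complex.Im R) w.
Proof.
set x := map_mx _ w; set y := map_mx (@complex.Im R) w.
move=> sA w0 /sub_rVP[[a b] wA].
have wAj j : ((x *m A) 0 j +i* (y *m A) 0 j)%C = (w *m map_mx (real_complex R) A) 0 j.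
  rewrite !mxE; apply/eqP; rewrite eq_complex /= !raddf_sum /=.
  by apply/andP; split; apply/eqP/eq_bigr => k _; rewrite !mxE;
    case: (w 0 k) => p q /=; rewrite ?mulr0 ?subr0 ?add0r.
have [xA yA] : x *m A = a *: x - b *: y /\ y *m A = b *: x + a *: y.
  by split; apply/rowP => j; move: (wAj j); rewrite wA [in X in _ = X -> _]mxE;
    case E: (w 0 j) => [p q] [xe ye]; rewrite ?xe ?ye !mxE E //= addrC.
have /eqP : b * ((x *m x^T) 0 0 + (y *m y^T) 0 0) = 0.
  have : x *m A *m y^T = (y *m A *m x^T)^T by rewrite !trmx_mul trmxK sA mulmxA.
  rewrite xA yA mulmxBl mulmxDl -!scalemxAl linearD !linearZ /=.
  rewrite !trmx_mul !trmxK => /matrixP/(_ 0 0).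
  rewrite !mxE => e; move: e; set s1 := \sum_(i | _) _; set s2 := \sum_(i | _) _.
  by set s3 := \sum_(i | _) _ => e; lra.
rewrite mulf_eq0 => /orP[/eqP b0|].
  by exists a; rewrite xA yA b0 !scale0r subr0 add0r.
rewrite paddr_eq0 ?mulmx_rV_tr_ge0 // => /andP[/eqP/mulmx_rV_tr_eq0 x0].
move=> /eqP/mulmx_rV_tr_eq0 y0; case/eqP: w0; apply/rowP => j.
move: x0 y0 => /rowP/(_ j) + /rowP/(_ j); rewrite !mxE.
by case: (w 0 j) => p q /= -> ->.
Qed.

(** Commuting matrices have a common eigenvector over [R[i]]; one of its real
    and imaginary parts is nonzero and is a common real eigenvector. *)
Lemma symmetric_common_eigenvector n (A B : 'M[R]_n.+1) :
    A^T = A -> B^T = B -> A *m B = B *m A ->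
  exists (v : 'rV[R]_n.+1) (a b : R),
    [/\ v *m v^T = 1%:M, v *m A = a *: v & v *m B = b *: v].
Proof.
move=> sA sB AB.
have [|w w0 /andP[wA wB]] := @common_eigenvector2 R[i] n.+1
  (map_mx (real_complex R) A) (map_mx (real_complex R) B) isT.
  by rewrite -!map_mxM AB.
have [a [xA yA]] := symmetric_complex_eigenvector sA w0 wA.
have [b [xB yB]] := symmetric_complex_eigenvector sB w0 wB.
have [v [v0 vA vB]] : exists v : 'rV[R]_n.+1,
    [/\ v != 0, v *m A = a *: v & v *m B = b *: v].
  have [x0|x0] := eqVneq (map_mx (@complex.Re R) w) 0; last first.
    by exists (map_mx (@complex.Re R) w).
  exists (map_mx (@complex.Im R) w); split=> //.
  apply: contraNneq w0 => y0; apply/eqP/rowP => j.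
  move: x0 y0 => /rowP/(_ j) + /rowP/(_ j); rewrite !mxE.
  by case: (w 0 j) => p q /= -> ->.
have vv : 0 < (v *m v^T) 0 0.
  rewrite lt_neqAle mulmx_rV_tr_ge0 andbT eq_sym.
  by apply: contraNneq v0 => /mulmx_rV_tr_eq0/eqP.
exists ((Num.sqrt ((v *m v^T) 0 0))^-1 *: v), a, b; split.
- rewrite linearZ /= -scalemxAl -scalemxAr scalerA -invfM -expr2 sqr_sqrtr ?ltW //.
  by rewrite [X in _ *: X]mx11_scalar scale_scalar_mx mulVf ?gt_eqF.
- by rewrite -scalemxAl vA !scalerA mulrC.
- by rewrite -scalemxAl vB !scalerA mulrC.
Qed.

(** The witness is the Householder reflection exchanging [v] and the first
    basis vector. *)
Lemma unit_row_extension n (v : 'rV[R]_n.+1) : v *m v^T = 1%:M ->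
  exists P : 'M[R]_n.+1, P *m P^T = 1%:M /\ row 0 P = v.
Proof.
move=> vv.
(* When v = e, N = 0, hence c = 0 and the reflection degenerates to 1. *)
pose e : 'rV[R]_n.+1 := delta_mx 0 0; pose w := v - e.
pose N := (w *m w^T) 0 0; pose c := 2 / N.
have wwE : w *m w^T = N%:M by rewrite [LHS]mx11_scalar.
pose K := w^T *m w.
have KT : (1%:M - c *: K)^T = 1%:M - c *: K.
  by rewrite [LHS]linearB /= trmx1 linearZ /= trmx_mul trmxK.
have KK : K *m K = N *: K.
  by rewrite /K mulmxA -(mulmxA _ w) wwE mul_mx_scalar scalemxAl.
have cN : N != 0 -> c * N = 2 by move=> N0; rewrite divfK.
exists (1%:M - c *: K); split.
  rewrite KT mulmxBl mul1mx mulmxBr mulmx1 -scalemxAl -scalemxAr KK.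
  have [/mulmx_rV_tr_eq0 w0|N0] := eqVneq N 0.
    by rewrite /K w0 mulmx0 !scaler0 !subr0.
  by rewrite [c *: (N *: K)]scalerA cN // scaler_nat mulr2n
    scalerDr opprB !addrA subrK addrK.
have ev : e *m w^T = (v 0 0 - 1)%:M.
  by rewrite [LHS]mx11_scalar -rowE !mxE !eqxx.
have NE : N = 2 - 2 * v 0 0.
  have ve : v *m e^T = (v 0 0)%:M.
    by rewrite trmx_delta -colE [LHS]mx11_scalar !mxE.
  have eV : e *m v^T = (v 0 0)%:M by rewrite [LHS]mx11_scalar -rowE !mxE.
  have ee : e *m e^T = 1%:M by rewrite [LHS]mx11_scalar -rowE !mxE !eqxx.
  have wT : w^T = v^T - e^T by rewrite [LHS]linearB.
  by rewrite /N wT mulmxBr !mulmxBl vv ve eV ee !mxE /= mulr1n; lra.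
have c1 : c *: (v 0 0 - 1)%:M *m w = - w.
  have [/mulmx_rV_tr_eq0 w0|N0] := eqVneq N 0; first by rewrite w0 mulmx0 oppr0.
  rewrite -scalemxAl mul_scalar_mx scalerA -[RHS]scaleN1r; congr (_ *: _).
  by have := cN N0; rewrite NE; lra.
rewrite rowE -/e mulmxBr mulmx1 -scalemxAr mulmxA ev scalemxAl c1.
by rewrite opprK addrC subrK.
Qed.

Lemma lift0_mx_orthogonal n (Q : 'M[R]_n) :
  Q *m Q^T = 1%:M -> lift0_mx Q *m (lift0_mx Q)^T = 1%:M.
Proof.
move=> QQ; rewrite tr_block_mx mulmx_block !trmx0 !trmx1.
by rewrite !(mulmx0, mul0mx, addr0, add0r, mulmx1, mul1mx) QQ -scalar_mx_block.
Qed.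

Lemma lift0_mx_diag n (Q M : 'M[R]_n) m : is_diag_mx (Q *m M *m Q^T) ->
  is_diag_mx (lift0_mx Q *m block_mx m%:M 0 0 M *m (lift0_mx Q)^T).
Proof.
move=> d; rewrite tr_block_mx !mulmx_block !trmx0 !trmx1.
rewrite !(mulmx0, mul0mx, addr0, add0r, mulmx1, mul1mx).
by rewrite is_diag_block_mx // d !eqxx scalar_mx_is_diag.
Qed.

(** A common unit eigenvector, taken as the first row of an orthogonal matrix,
    splits off a 1 x 1 block from both matrices, by symmetry; then induction. *)
Lemma codiagonalization n (A B : 'M[R]_n) :
    A^T = A -> B^T = B -> A *m B = B *m A ->
  exists P : 'M[R]_n, [/\ P *m P^T = 1%:M, is_diag_mx (P *m A *m P^T) &
    is_diag_mx (P *m B *m P^T)].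
Proof.
elim: n A B => [|n IH] A B sA sB AB.
  by exists 1%:M; split; [rewrite trmx1 mulmx1|apply/is_diag_mxP => -[]..].
have [v [a [b [vv vA vB]]]] := symmetric_common_eigenvector sA sB AB.
have [P [PP Pv]] := unit_row_extension vv.
have split_off M m : M^T = M -> v *m M = m *: v ->
    exists M' : 'M_n, M'^T = M' /\
      P *m M *m P^T = block_mx m%:M 0 0 M' :> 'M_(1 + n).
  move=> sM vM; have [M1 EM1] : exists M1 : 'M_(1 + n), M1 = P *m M *m P^T by eexists.
  have sM1 : M1^T = M1 by rewrite EM1 !trmx_mul trmxK sM mulmxA.
  have r0 j : M1 0 j = m * (0 == j)%:R.
    transitivity ((row 0 P *m M *m P^T) 0 j); first by rewrite -!row_mul EM1 [RHS]mxE.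
    by rewrite Pv vM -scalemxAl -Pv -row_mul PP !mxE.
  exists (drsubmx M1); split; first by rewrite -{2}sM1 trmx_drsub.
  rewrite -EM1 -[LHS](@submxK _ 1 n 1 n); congr (@block_mx _ 1 n 1 n _ _ _ _).
  - by apply/matrixP => i j; rewrite !ord1 !mxE lshift0 r0 eqxx mulr1.
  - by apply/matrixP => i j; rewrite !ord1 !mxE lshift0 r0 mulr0.
  - by apply/matrixP => i j; rewrite !ord1 -sM1 !mxE lshift0 r0 mulr0.
have [A' [sA' EA]] := split_off A a sA vA.
have [B' [sB' EB]] := split_off B b sB vB.
have PtP : P^T *m P = 1%:M by apply: mulmx1C.
have A'B' : A' *m B' = B' *m A'.
  have : P *m A *m P^T *m (P *m B *m P^T) = P *m B *m P^T *m (P *m A *m P^T).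
    rewrite !mulmxA -!(mulmxA _ P^T P) PtP !mulmx1 -(mulmxA P A) -(mulmxA P B).
    by rewrite AB.
  rewrite EA EB => E.
  have {E} : block_mx a%:M 0 0 A' *m block_mx b%:M 0 0 B' =
    block_mx b%:M 0 0 B' *m block_mx a%:M 0 0 A' :> 'M_(1 + n) by [].
  rewrite !mulmx_block !mulmx0 !mul0mx !add0r.
  by case/eq_block_mx.
have [Q [QQ dA dB]] := IH A' B' sA' sB' A'B'.
pose S : 'M_n.+1 := lift0_mx Q.
have SS : S *m S^T = 1%:M := lift0_mx_orthogonal QQ.
have conj_mul (M : 'M_n.+1) :
    (S *m P) *m M *m (S *m P)^T = S *m (P *m M *m P^T) *m S^T.
  by rewrite trmx_mul !mulmxA.
exists (S *m P); split.
- by rewrite trmx_mul mulmxA -(mulmxA S) PP mulmx1 SS.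
- by rewrite conj_mul EA; apply: lift0_mx_diag.
- by rewrite conj_mul EB; apply: lift0_mx_diag.
Qed.
End Codiagonalization.

(** * Linear forms and orthonormal frames *)

Section Frames.
Variables (R : realType) (T : vectType R) (g : {dot T for idfun}).
Implicit Types (u v : 4.-tuple T) (x y z w : T).

Lemma scalar_dotl y : scalar (fun x => g x y).
Proof. by move=> a x z; rewrite linearPl. Qed.

Lemma scalar_dotr x : scalar (g x).
Proof. by move=> a y z; rewrite linearPr. Qed.

Lemma functional0 (f : T -> R) : scalar f -> f 0 = 0.
Proof. by move=> lf; have := lf (-1) 0 0; rewrite scaler0 addr0 mulN1r addNr. Qed.

Lemma functionalD (f : T -> R) : scalar f -> {morph f : x y / x + y}.
Proof. by move=> lf x y; have := lf 1 x y; rewrite scale1r mul1r. Qed.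

Lemma functionalZ (f : T -> R) a x : scalar f -> f (a *: x) = a * f x.
Proof. by move=> lf; have := lf a x 0; rewrite !addr0 (functional0 lf) addr0. Qed.

Lemma dotZl a x y : g (a *: x) y = a * g x y.
Proof. exact: functionalZ (scalar_dotl y). Qed.

Lemma dotZr a x y : g x (a *: y) = a * g x y.
Proof. exact: functionalZ (scalar_dotr x). Qed.

Lemma scalar_add (f f' : T -> R) :
  scalar f -> scalar f' -> scalar (fun x => f x + f' x).
Proof. by move=> lf lf' a x y; rewrite lf lf' mulrDr addrACA. Qed.

Lemma scalar_opp (f : T -> R) : scalar f -> scalar (fun x => - f x).
Proof. by move=> lf a x y; rewrite lf opprD mulrN. Qed.

Lemma dot_onb_nat u (i j : nat) : orthonormal_basis g u ->
  (i < 4)%N -> (j < 4)%N -> g u`_i u`_j = (i == j)%:R.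
Proof. by move=> hu hi hj; apply: (dot_onb hu (Ordinal hi) (Ordinal hj)). Qed.

Lemma onb_of_dot u v : orthonormal_basis g u ->
  (forall i j : 'I_4, g v`_i v`_j = (i == j)%:R) -> orthonormal_basis g v.
Proof.
move=> [bu _] dv; split; last first.
  move: dv; case: v => -[|a [|b [|c [|d [|//]]]]] //= sz dv.
  rewrite /orthonormal /ortho_rec /=.
  have D i j (hi : (i < 4)%N) (hj : (j < 4)%N) := dv (Ordinal hi) (Ordinal hj).
  rewrite (D 0 0 isT isT) (D 1 1 isT isT) (D 2 2 isT isT) (D 3 3 isT isT).
  rewrite (D 0 1 isT isT) (D 0 2 isT isT) (D 0 3 isT isT).
  by rewrite (D 1 2 isT isT) (D 1 3 isT isT) (D 2 3 isT isT) /= !eqxx.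
have fv : free v.
  apply/freeP => k k0 i; have := congr1 (g v`_i) k0.
  rewrite (functional0 (scalar_dotr _)) (scalar_sum k (fun j => v`_j) (scalar_dotr _)).
  rewrite (bigD1 i) //= dv eqxx mulr1 big1 ?addr0 // => j /negPf ji.
  by rewrite dv eq_sym ji mulr0.
by rewrite basisEfree fv subvf (size_basis bu) size_tuple leqnn.
Qed.

Lemma mem_distinct (i j k l : 'I_4) : uniq [:: i; j; k; l] ->
  [:: i; j; k; l] =i enum 'I_4.
Proof.
move=> un; apply: (uniq_min_size un _ _).2 => [m _|]; first by rewrite mem_enum.
by rewrite size_enum_ord.
Qed.

Lemma sum_distinct (V : zmodType) (f : 'I_4 -> V) (i j k l : 'I_4) :
  uniq [:: i; j; k; l] -> \sum_(m < 4) f m = f i + f j + f k + f l.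
Proof.
move=> un; rewrite -big_enum.
rewrite -(perm_big _ (uniq_perm un (enum_uniq _) (mem_distinct un))) /=.
by rewrite !big_cons big_nil addr0 !addrA.
Qed.
End Frames.

(** * The Weyl tensor and its action on bivectors *)

Section Weyl.
Variables (R : realType) (T : vectType R) (g : {dot T for idfun}).
Variables (o : 4.-tuple T) (ho : orthonormal_basis g o).
Variables (F : tensor4 T) (hF : algebraic_curvature_tensor F).
Implicit Types (u v : 4.-tuple T) (x y z w : T).

Lemma ricci_sym x y : ricci o F x y = ricci o F y x.
Proof. by apply: eq_bigr => k _; apply: (act_pair hF). Qed.

Lemma scalar_ricci y : scalar (ricci o F y).
Proof. by apply: scalar_sumf => k; apply: (act_linear3 hF). Qed.

Lemma weyl_act : algebraic_curvature_tensor (weyl g o F).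
Proof.
have L1 y a x x' : g (a *: x + x') y = a * g x y + g x' y := scalar_dotl g y a x x'.
have L2 y a x x' : g y (a *: x + x') = a * g y x + g y x' := scalar_dotr g y a x x'.
have r2 := scalar_ricci.
have r1 y : scalar ((ricci o F)^~ y).
  by move=> a x x' /=; rewrite ricci_sym r2 !(ricci_sym y).
split=> [y z w a x x'|x z w a y y'|x y w a z z'|x y z a w w'|x y z w|x y z w
         |x y z w|x y z w]; rewrite /weyl.
- by rewrite (act_linear1 hF) !(r1, r2, L1, L2); field.
- by rewrite (act_linear2 hF) !(r1, r2, L1, L2); field.
- by rewrite (act_linear3 hF) !(r1, r2, L1, L2); field.
- by rewrite (act_linear4 hF) !(r1, r2, L1, L2); field.
- by rewrite (act_skew12 hF); field.
- by rewrite (act_skew34 hF); field.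
- rewrite (act_pair hF) !(dotC g z) !(dotC g w).
  by rewrite (ricci_sym y w) (ricci_sym x z) (ricci_sym y z) (ricci_sym x w); field.
- have := act_bianchi hF x y z w.
  rewrite (ricci_sym y x) (ricci_sym z x) (ricci_sym z y).
  rewrite (dotC g y x) (dotC g z x) (dotC g z y).
  set A := F x y z w; set B := F y z x w; set C := F z x y w => E.
  have -> : A = - B - C by lra.
  by field.
Qed.

Lemma weyl_traceless x y : \sum_(k < 4) weyl g o F x o`_k y o`_k = 0.
Proof.
have sg : \sum_(k < 4) g x o`_k * ricci o F o`_k y = ricci o F x y.
  rewrite ricci_sym [in RHS](onb_expand x ho) (scalar_sum _ _ (scalar_ricci y)).
  by apply: eq_bigr => k _; rewrite (ricci_sym y).
have sg' : \sum_(k < 4) g o`_k y * ricci o F x o`_k = ricci o F x y.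
  rewrite [in RHS](onb_expand y ho) (scalar_sum _ _ (scalar_ricci x)).
  by apply: eq_bigr => k _; rewrite dotC.
have sgg : \sum_(k < 4) g x o`_k * g o`_k y = g x y.
  by rewrite -(parseval _ _ ho); apply: eq_bigr => k _; rewrite (dotC g x).
have sd : \sum_(k < 4) g o`_k o`_k = 4.
  rewrite (eq_bigr (fun=> 1)) ?sumr_const ?card_ord // => k _.
  by rewrite (dot_onb ho) eqxx.
rewrite /weyl big_split /= sumrB -mulr_suml -mulr_sumr !(sumrB, big_split) /=.
rewrite -!mulr_sumr -!mulr_suml sg sg' sgg sd.
rewrite -/(scal o F) -/(ricci o F x y).
by field.
Qed.

(** By the Bianchi identity, [W_xayb - W_xbya = W_xyab]: this is the equality
    of the two formulas for the action of [W] on bivectors. *)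
Lemma weyl_action_wedge a b x y :
  weyl_action g o F (wedge g a b) x y = weyl g o F x y a b.
Proof.
have hW := weyl_act.
have E c d : \sum_(p < 4) \sum_(q < 4) weyl g o F x o`_p y o`_q *
    (g c o`_p * g d o`_q) = weyl g o F x c y d.
  rewrite [in RHS](onb_expand c ho) (scalar_sum _ _ (act_linear2 hW _ _ _)).
  apply: eq_bigr => p _; rewrite [in RHS](onb_expand d ho).
  rewrite (scalar_sum _ _ (act_linear4 hW _ _ _)) mulr_sumr.
  by apply: eq_bigr => q _; rewrite mulrC mulrA.
rewrite /weyl_action /wedge.
under eq_bigr => p _ do under eq_bigr => q _ do rewrite mulrBr [g a o`_q * _]mulrC.
under eq_bigr => p _ do rewrite sumrB.
rewrite sumrB !E.
have := act_bianchi hW x y a b.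
by rewrite (act_pair hW y a x b) (act_skew12 hW a x y b); lra.
Qed.

Lemma wedge_bilinear a b :
  (forall y, scalar (fun x => wedge g a b x y)) /\
  (forall x, scalar (fun y => wedge g a b x y)).
Proof.
split=> z; apply: scalar_add; [|apply: scalar_opp| |apply: scalar_opp];
  by [apply: scalar_mulr; apply: scalar_dotr|apply: scalar_mull; apply: scalar_dotr].
Qed.

Lemma wedge_bivector a b : bivector (wedge g a b).
Proof.
have [l1 l2] := wedge_bilinear a b; split=> // x y.
by rewrite /wedge opprB [g a x * _]mulrC [g a y * _]mulrC.
Qed.

Lemma bivector_expand u b x y : orthonormal_basis g u -> bivector b ->
  b x y = \sum_(i < 4) \sum_(j < 4) b u`_i u`_j * (g u`_i x * g u`_j y).
Proof.
move=> hu hb.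
rewrite [in LHS](onb_expand x hu) (scalar_sum _ _ (biv_linear1 hb _)).
apply: eq_bigr => i _; rewrite [in LHS](onb_expand y hu).
rewrite (scalar_sum _ _ (biv_linear2 hb _)) mulr_sumr.
by apply: eq_bigr => j _; rewrite (dotC g x) (dotC g y); ring.
Qed.

(** The order 01, 02, 03, 23, 31, 12 of the six index pairs, used throughout,
    puts each of the first three pairs against its oriented complement. *)
Lemma bivector_wedge u b x y : orthonormal_basis g u -> bivector b ->
  b x y = b u`_0 u`_1 * wedge g u`_0 u`_1 x y + b u`_0 u`_2 * wedge g u`_0 u`_2 x y
    + b u`_0 u`_3 * wedge g u`_0 u`_3 x y + b u`_2 u`_3 * wedge g u`_2 u`_3 x y
    + b u`_3 u`_1 * wedge g u`_3 u`_1 x y + b u`_1 u`_2 * wedge g u`_1 u`_2 x y.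
Proof.
move=> hu hb; rewrite (bivector_expand _ _ hu hb).
have b0 z : b z z = 0 by have := biv_skew hb z z; lra.
rewrite !big_ord_recl !big_ord0 /= /bump /= !b0 /wedge.
rewrite (biv_skew hb u`_1 u`_0) (biv_skew hb u`_2 u`_0) (biv_skew hb u`_3 u`_0).
rewrite (biv_skew hb u`_2 u`_1) (biv_skew hb u`_3 u`_2) (biv_skew hb u`_1 u`_3).
by ring.
Qed.

End Weyl.

(** * The Hodge operator and the diagonalization of W on both halves *)

Section Hodge.
Variables (R : realType) (T : vectType R) (g : {dot T for idfun}).
Implicit Types (u v : 4.-tuple T) (x y z w : T).

(** Entries indexed by [nat] keep the minors of the Laplace expansion of this
    same form, so that the expansion can be iterated by rewriting. *)
Definition natmx n (f : nat -> nat -> R) : 'M_n := \matrix_(i, j) f i j.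

Lemma det_natmx n (f : nat -> nat -> R) :
  \det (natmx n.+1 f) =
  \sum_(j < n.+1) (-1) ^+ j * f 0%N j *
     \det (natmx n (fun i k => f i.+1 (bump j k))).
Proof.
rewrite (expand_det_row _ ord0); apply: eq_bigr => j _.
rewrite /cofactor !mxE add0n mulrCA mulrA; congr (_ * \det _).
by apply/matrixP => i k; rewrite !mxE.
Qed.

(** Laplace expansion along the first two rows. *)
Lemma volumeE u x y z w : volume g u x y z w =
  wedge g u`_0 u`_1 x y * wedge g u`_2 u`_3 z w
  + wedge g u`_0 u`_2 x y * wedge g u`_3 u`_1 z w
  + wedge g u`_0 u`_3 x y * wedge g u`_1 u`_2 z w
  + wedge g u`_2 u`_3 x y * wedge g u`_0 u`_1 z w
  + wedge g u`_3 u`_1 x y * wedge g u`_0 u`_2 z w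
  + wedge g u`_1 u`_2 x y * wedge g u`_0 u`_3 z w.
Proof.
have -> : volume g u x y z w =
  \det (natmx 4 (fun i j => g [:: x; y; z; w]`_i u`_j)) by [].
do 3 rewrite !det_natmx !big_ord_recl !big_ord0.
rewrite !det_mx11 !mxE /bump /= /wedge.
rewrite !(dotC g u`_0) !(dotC g u`_1) !(dotC g u`_2) !(dotC g u`_3).
ring.
Qed.

Lemma wedge_contraction u b x y : orthonormal_basis g u -> bivector b ->
  \sum_(k < 4) \sum_(l < 4) wedge g x y u`_k u`_l * b u`_k u`_l = 2 * b x y.
Proof.
move=> hu hb.
have E z w : \sum_(k < 4) \sum_(l < 4) g u`_k z * g u`_l w * b u`_k u`_l = b z w.
  rewrite (bivector_expand _ _ hu hb); apply: eq_bigr => k _.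
  by apply: eq_bigr => l _; rewrite mulrC.
rewrite /wedge.
under eq_bigr => k _ do under eq_bigr => l _ do
  rewrite mulrBl !(dotC g x) !(dotC g y) [X in _ - X * _]mulrC.
under eq_bigr => k _ do rewrite sumrB.
rewrite sumrB !E (biv_skew hb y x); lra.
Qed.

Section Oriented.
Variables (o u : 4.-tuple T).
Hypotheses (ho : orthonormal_basis g o) (pu : positive_orthonormal_basis g o u).
Let hu : orthonormal_basis g u := pu.1.

(** In a positive orthonormal frame the Hodge operator exchanges each
    [u_i /\ u_j] with its oriented complement. *)
Lemma hodge_frame b x y : bivector b -> hodge g o b x y =
  b u`_2 u`_3 * wedge g u`_0 u`_1 x y + b u`_3 u`_1 * wedge g u`_0 u`_2 x y
  + b u`_1 u`_2 * wedge g u`_0 u`_3 x y + b u`_0 u`_1 * wedge g u`_2 u`_3 x y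
  + b u`_0 u`_2 * wedge g u`_3 u`_1 x y + b u`_0 u`_3 * wedge g u`_1 u`_2 x y.
Proof.
move=> hb; rewrite /hodge.
under eq_bigr => k _ do under eq_bigr => l _ do
  rewrite -(volume_indep _ _ _ _ ho pu) volumeE !mulrDl -!mulrA.
under eq_bigr => k _ do rewrite !big_split -!mulr_sumr /=.
rewrite !big_split -!mulr_sumr /= !(wedge_contraction _ _ ho hb).
by rewrite /wedge; field.
Qed.

Lemma wedge_onb i j k l : (i < 4)%N -> (j < 4)%N -> (k < 4)%N -> (l < 4)%N ->
  wedge g u`_i u`_j u`_k u`_l =
    (i == k)%:R * (j == l)%:R - (i == l)%:R * (j == k)%:R.
Proof. by move=> *; rewrite /wedge !(dot_onb_nat hu). Qed.

Lemma Lambda_frame_bivector s i : bivector (Lambda_frame g s u i).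
Proof.
have comb c a b a' b' : bivector (fun x y => wedge g a b x y + c * wedge g a' b' x y).
  have [l1 l2 sk] := wedge_bivector g a b; have [l1' l2' sk'] := wedge_bivector g a' b'.
  split=> [y|x|x y]; last by rewrite sk sk'; ring.
    by apply: scalar_add => //; apply: scalar_mull.
  by apply: scalar_add => //; apply: scalar_mull.
by case: i => [[|[|[|//]]] ?]; apply: comb.
Qed.

(** A bivector [w] lies in [Lambda s] exactly when its components on
    23, 31, 12 are [(-1)^s] times those on 01, 02, 03. *)
Lemma Lambda_frame_basis s : Lambda_basis g o s (Lambda_frame g s u).
Proof.
have ee : (-1) ^+ s * (-1) ^+ s = 1 :> R by rewrite -signr_addb addbb.
split=> [i|w [hw sw]].
  split=> [|x y]; first exact: Lambda_frame_bivector.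
  rewrite (hodge_frame _ _ (Lambda_frame_bivector _ _)) /Lambda_frame.
  move: ee; set e := (-1) ^+ s => ee.
  by case: i => [[|[|[|//]]] ?] /=; rewrite !wedge_onb //=; ring: ee.
have w23 : w u`_2 u`_3 = (-1) ^+ s * w u`_0 u`_1.
  by rewrite -sw (hodge_frame _ _ hw) !wedge_onb //=; ring.
have w31 : w u`_3 u`_1 = (-1) ^+ s * w u`_0 u`_2.
  by rewrite -sw (hodge_frame _ _ hw) !wedge_onb //=; ring.
have w12 : w u`_1 u`_2 = (-1) ^+ s * w u`_0 u`_3.
  by rewrite -sw (hodge_frame _ _ hw) !wedge_onb //=; ring.
exists [ffun i : 'I_3 => w u`_0 u`_i.+1]; split=> [x y|a wa].
  rewrite [LHS](bivector_wedge _ _ hu hw) w23 w31 w12.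
  by rewrite !big_ord_recl big_ord0 !ffunE /Lambda_frame /= /bump /=; ring.
apply/ffunP => i; rewrite ffunE wa !big_ord_recl big_ord0 /Lambda_frame /= /bump /=.
case: i => [[|[|[|//]]] hi] /=; rewrite !wedge_onb //=.
- by rewrite (_ : Ordinal hi = ord0); [ring|apply: val_inj].
- by rewrite (_ : Ordinal hi = lift ord0 ord0); [ring|apply: val_inj].
- by rewrite (_ : Ordinal hi = lift ord0 (lift ord0 ord0)); [ring|apply: val_inj].
Qed.

Variable F : tensor4 T.
Hypothesis hF : algebraic_curvature_tensor F.
Notation W := (weyl g o F).

(** The six equations say that [W] maps each [u_i /\ u_j] to a multiple of its
    oriented complement.  Equivalently, with respect to the unit vector [u_0],
    the electric part [W(u_0, ., u_0, .)] vanishes and the magnetic part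
    [W(u_0, ., *(u_0, .))] is diagonal. *)
Record magnetic c2 c3 c4 : Prop := Magnetic {
  magnetic01 : forall x y, W x y u`_0 u`_1 = c2 * wedge g u`_2 u`_3 x y;
  magnetic02 : forall x y, W x y u`_0 u`_2 = c3 * wedge g u`_3 u`_1 x y;
  magnetic03 : forall x y, W x y u`_0 u`_3 = c4 * wedge g u`_1 u`_2 x y;
  magnetic23 : forall x y, W x y u`_2 u`_3 = c2 * wedge g u`_0 u`_1 x y;
  magnetic31 : forall x y, W x y u`_3 u`_1 = c3 * wedge g u`_0 u`_2 x y;
  magnetic12 : forall x y, W x y u`_1 u`_2 = c4 * wedge g u`_0 u`_3 x y }.

Lemma weyl_action_Lambda_frame s (i : 'I_3) x y :
  weyl_action g o F (Lambda_frame g s u i) x y =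
  [:: W x y u`_0 u`_1 + (-1) ^+ s * W x y u`_2 u`_3;
      W x y u`_0 u`_2 + (-1) ^+ s * W x y u`_3 u`_1;
      W x y u`_0 u`_3 + (-1) ^+ s * W x y u`_1 u`_2]`_i.
Proof.
have E a b c d e : weyl_action g o F
    (fun x y => wedge g a b x y + e * wedge g c d x y) x y =
    W x y a b + e * W x y c d.
  rewrite -!(weyl_action_wedge ho hF) /weyl_action mulr_sumr -big_split.
  apply: eq_bigr => p _; rewrite mulr_sumr -big_split.
  by apply: eq_bigr => q _ /=; ring.
by case: i => [[|[|[|//]]] ?] /=; rewrite -E.
Qed.

(** Adding and subtracting the eigenvalue equations for the two signs
    separates the action of [W] on [u_i /\ u_j] and on its complement. *)
Lemma magneticP c2 c3 c4 :
  (forall s : bool, weyl_diagonalized_by g o F s (Lambda_frame g s u)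
     [tuple (-1) ^+ s * c2; (-1) ^+ s * c3; (-1) ^+ s * c4]) <->
  magnetic c2 c3 c4.
Proof.
split=> [h|[h01 h02 h03 h23 h31 h12] s].
  have H s i x y := (h s).2 i x y.
  have Hp i x y : _ := H false i x y; have Hm i x y : _ := H true i x y.
  split=> x y; [move: (Hp 0 x y) (Hm 0 x y)|move: (Hp 1 x y) (Hm 1 x y)
    |move: (Hp 2 x y) (Hm 2 x y)|move: (Hp 0 x y) (Hm 0 x y)
    |move: (Hp 1 x y) (Hm 1 x y)|move: (Hp 2 x y) (Hm 2 x y)];
    by rewrite !weyl_action_Lambda_frame /Lambda_frame /= expr0 expr1; lra.
have ee : (-1) ^+ s * (-1) ^+ s = 1 :> R by rewrite -signr_addb addbb.
split=> [|i x y]; first exact: Lambda_frame_basis.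
rewrite weyl_action_Lambda_frame /Lambda_frame; move: ee; set e := (-1) ^+ s => ee.
by case: i => [[|[|[|//]]] ?] /=; rewrite ?(h01, h02, h03, h23, h31, h12); ring: ee.
Qed.

End Oriented.
End Hodge.

(** * Frame components of the weakly Einstein tensor *)

Section Components.
Variables (R : realType) (T : vectType R) (g : {dot T for idfun}).
Variables (o u : 4.-tuple T).
Hypotheses (ho : orthonormal_basis g o) (hu : orthonormal_basis g u).
Variables (F : tensor4 T) (hF : algebraic_curvature_tensor F).
Notation W := (weyl g o F).
Let hW : algebraic_curvature_tensor W := weyl_act g o hF.

Lemma act_diag1 (G : tensor4 T) x z w : algebraic_curvature_tensor G -> G x x z w = 0.
Proof. by move=> hG; have := act_skew12 hG x x z w; lra. Qed.

Lemma act_diag2 (G : tensor4 T) x y z : algebraic_curvature_tensor G -> G x y z z = 0.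
Proof. by move=> hG; have := act_skew34 hG x y z z; lra. Qed.

Lemma weyl_trace_frame x y : \sum_(k < 4) W x u`_k y u`_k = 0.
Proof.
rewrite -[RHS](weyl_traceless hu hF x y); apply: eq_bigr => k _.
exact: (weyl_indep _ _ _ _ ho hu hF).
Qed.

Lemma weyl_trace_distinct x y (i j k l : 'I_4) : uniq [:: i; j; k; l] ->
  W x u`_i y u`_i + W x u`_j y u`_j + W x u`_k y u`_k + W x u`_l y u`_l = 0.
Proof. by move=> un; rewrite -[RHS](weyl_trace_frame x y) (sum_distinct _ un). Qed.

(** The trace of [W] over the pair [k, l] has only the two terms displayed. *)
Lemma weyl_complement_offdiag (i j k l : 'I_4) : uniq [:: i; j; k; l] ->
  W u`_i u`_k u`_i u`_l = - W u`_j u`_k u`_j u`_l.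
Proof.
move=> un; have := weyl_trace_distinct u`_k u`_l un.
rewrite (act_diag1 _ _ _ hW) (act_diag2 _ _ _ hW).
rewrite (act_skew12 hW u`_k u`_i) (act_skew34 hW _ _ u`_l u`_i).
by rewrite (act_skew12 hW u`_k u`_j) (act_skew34 hW _ _ u`_l u`_j); lra.
Qed.

(** The four vanishing traces [W_iaia] determine each sectional value by
    those of the other planes; eliminating leaves complementary planes with
    equal values. *)
Lemma weyl_complement (i j k l : 'I_4) : uniq [:: i; j; k; l] ->
  W u`_i u`_j u`_i u`_j = W u`_k u`_l u`_k u`_l.
Proof.
move=> un.
have := weyl_trace_distinct u`_i u`_i un; have := weyl_trace_distinct u`_j u`_j un.
have := weyl_trace_distinct u`_k u`_k un; have := weyl_trace_distinct u`_l u`_l un.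
rewrite !(act_diag1 _ _ _ hW).
have sw a b : W u`_a u`_b u`_a u`_b = W u`_b u`_a u`_b u`_a.
  by rewrite (act_skew12 hW) (act_skew34 hW) opprK.
rewrite !(sw j i) !(sw k i) !(sw l i) !(sw k j) !(sw l j) !(sw l k); lra.
Qed.

Definition curvature_square x y : R :=
  \sum_(k < 4) \sum_(p < 4) \sum_(q < 4)
     F x u`_k u`_p u`_q * F y u`_k u`_p u`_q.

Variable mu : 4.-tuple R.
Hypotheses (s0 : scal o F = 0)
  (de : diagonalized_by g (einstein_tensor g o F) u mu).

Lemma ricci_diag (i : 'I_4) x : ricci o F u`_i x = mu`_i * g u`_i x.
Proof. by rewrite -de /einstein_tensor s0 !mul0r subr0. Qed.

Lemma curvature_weyl x y z w : F x y z w = W x y z w +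
  (g x z * ricci o F y w + g y w * ricci o F x z
   - g x w * ricci o F y z - g y z * ricci o F x w) / 2.
Proof. by rewrite /weyl s0; field. Qed.

Lemma mu_sum (i j k l : 'I_4) : uniq [:: i; j; k; l] ->
  mu`_i + mu`_j + mu`_k + mu`_l = 0.
Proof.
move=> un; rewrite -(sum_distinct (fun m : 'I_4 => mu`_m) un) -[RHS]s0.
rewrite (scal_indep ho hu hF); apply: eq_bigr => m _.
by rewrite -(ricci_indep ho hu hF) ricci_diag (dot_onb hu) eqxx mulr1.
Qed.

(** For zero scalar curvature, [R = W + (g * e) / 2] with [*] the
    Kulkarni-Nomizu product, which is diagonal on the [u_p /\ u_q] with
    eigenvalues [(mu_p + mu_q) / 2]. *)
Lemma curvature_frame (p q r s : 'I_4) : F u`_p u`_q u`_r u`_s =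
  W u`_p u`_q u`_r u`_s + (mu`_p + mu`_q) / 2 *
    ((p == r)%:R * (q == s)%:R - (p == s)%:R * (q == r)%:R).
Proof.
rewrite curvature_weyl !ricci_diag !(dot_onb hu).
by field.
Qed.

Section Distinct.
Variables (i j k l : 'I_4).
Hypothesis un : uniq [:: i; j; k; l].
Local Notation a := (u`_i).
Local Notation b := (u`_j).
Local Notation c := (u`_k).
Local Notation d := (u`_l).

Lemma curvature_square_pairs x y : curvature_square x y =
  2 * \sum_(m < 4)
   (F x u`_m a b * F y u`_m a b + F x u`_m a c * F y u`_m a c
    + F x u`_m a d * F y u`_m a d + F x u`_m b c * F y u`_m b c
    + F x u`_m b d * F y u`_m b d + F x u`_m c d * F y u`_m c d).
Proof.
rewrite mulr_sumr; apply: eq_bigr => m _; set z := u`_m.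
rewrite (sum_distinct _ un) !(sum_distinct _ un) !(act_diag2 _ _ _ hF).
rewrite !(act_skew34 hF _ _ b a) !(act_skew34 hF _ _ c a) !(act_skew34 hF _ _ d a).
rewrite !(act_skew34 hF _ _ c b) !(act_skew34 hF _ _ d b) !(act_skew34 hF _ _ d c).
by ring.
Qed.

Lemma distinct_neq : ((i == j) = false) * ((i == k) = false) *
  ((i == l) = false) * ((j == k) = false) * ((j == l) = false) *
  ((k == l) = false) * ((j == i) = false) * ((k == i) = false) *
  ((l == i) = false) * ((k == j) = false) * ((l == j) = false) *
  ((l == k) = false).
Proof.
move: un; rewrite /= !inE !negb_or => /and4P[/and3P[ij ik il] /andP[jk jl] kl _].
by do ?split; apply/negbTE; rewrite // eq_sym.
Qed.

(** The terms quadratic in [W] contribute a multiple of [g], and so do those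
    quadratic in [e], because [(mu_i + mu_j)^2 = (mu_k + mu_l)^2]; only the
    products of [W] with [e] are left in the trace-free combinations formed here. *)
Lemma curvature_square_table :
  (curvature_square c d = 2 * (mu`_i - mu`_j) * W a c a d) *
  (curvature_square a a + curvature_square b b - curvature_square c c
   - curvature_square d d = 8 * (mu`_i + mu`_j) * W a b a b).
Proof.
(* The symmetries of W and its tracelessness (e1 to e6, and the complementary
   planes) leave twelve components; the relations e7 and e8 between these make
   the terms quadratic in W cancel. *)
have un1 : uniq [:: i; l; j; k] by rewrite /= !inE !distinct_neq.
have un1' : uniq [:: i; k; j; l] by rewrite /= !inE !distinct_neq.
have un3 : uniq [:: j; l; i; k] by rewrite /= !inE !distinct_neq.
have un4 : uniq [:: j; k; i; l] by rewrite /= !inE !distinct_neq.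
have un5 : uniq [:: k; l; i; j] by rewrite /= !inE !distinct_neq.
have flip x y z w : W x y z w = W y x w z.
  by rewrite (act_skew12 hW) (act_skew34 hW) opprK.
have e_mu : mu`_l = - (mu`_i + mu`_j + mu`_k) by have := mu_sum un; lra.
have e1 : W b d c d = - W a b a c.
  by rewrite (weyl_complement_offdiag un1) flip opprK.
have e2 : W b c c d = W a b a d.
  by rewrite (weyl_complement_offdiag un1') (act_skew12 hW).
have e3 : W b c b d = - W a c a d.
  by rewrite (weyl_complement_offdiag un) opprK.
have e4 : W a d c d = W a b b c.
  rewrite (act_skew12 hW a b) (weyl_complement_offdiag un3) opprK.
  exact: flip.
have e5 : W a c c d = - W a b b d.
  rewrite (act_skew12 hW a b) (weyl_complement_offdiag un4) opprK.
  exact: (act_skew12 hW).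
have e6 : W a d b d = - W a c b c.
  by rewrite [RHS](congr1 -%R (flip _ _ _ _)) (weyl_complement_offdiag un5) opprK flip.
have e7 : W a b c d = W a c b d - W a d b c.
  have := act_bianchi hW a b c d.
  by rewrite (act_pair hW b c) (act_skew12 hW c a); lra.
have e8 : W a d a d = - W a b a b - W a c a c.
  by have := weyl_trace_distinct a a un; rewrite (act_diag1 _ _ _ hW); lra.
rewrite !curvature_square_pairs !(sum_distinct _ un).
rewrite !(act_diag1 _ _ _ hF) !(act_skew12 hF b a) !(act_skew12 hF c a).
rewrite !(act_skew12 hF d a) !(act_skew12 hF c b) !(act_skew12 hF d b).
rewrite !(act_skew12 hF d c) !curvature_frame !distinct_neq !eqxx.
rewrite !(act_pair hW a c a b) !(act_pair hW a d a b) !(act_pair hW a d a c).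
rewrite !(act_pair hW b c a b) !(act_pair hW b c a c) !(act_pair hW b c a d).
rewrite !(act_pair hW b d a b) !(act_pair hW b d a c) !(act_pair hW b d a d).
rewrite !(act_pair hW b d b c) !(act_pair hW c d a b) !(act_pair hW c d a c).
rewrite !(act_pair hW c d a d) !(act_pair hW c d b c) !(act_pair hW c d b d).
rewrite e1 e2 e3 e4 e5 e6 e_mu -(weyl_complement un) -(weyl_complement un1').
rewrite -(weyl_complement un1) e7 e8.
by split=> /=; field.
Qed.

End Distinct.
End Components.

(** * The weakly Einstein condition in an eigenframe *)

Lemma complement_pair (i j : 'I_4) : i != j ->
  exists k l : 'I_4, uniq [:: k; l; i; j].
Proof.
pose s i j := [seq m <- [:: ord0; lift ord0 ord0; lift ord0 (lift ord0 ord0); ord_max]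
  | (m != i) && (m != j)] : seq 'I_4.
move=> ij; exists (nth ord0 (s i j) 0), (nth ord0 (s i j) 1); move: ij.
by case: i => [[|[|[|[|//]]]] ?]; case: j => [[|[|[|[|//]]]] ?].
Qed.

Lemma complement_point (i j k : 'I_4) : uniq [:: i; j; k] ->
  exists l : 'I_4, uniq [:: i; l; j; k].
Proof.
pose s i j k := [seq m <- [:: ord0; lift ord0 ord0; lift ord0 (lift ord0 ord0); ord_max]
  | [&& m != i, m != j & m != k]] : seq 'I_4.
move=> un; exists (nth ord0 (s i j k) 0); move: un.
by case: i => [[|[|[|[|//]]]] ?]; case: j => [[|[|[|[|//]]]] ?];
  case: k => [[|[|[|[|//]]]] ?].
Qed.

Section WeaklyEinstein.
Variables (R : realType) (T : vectType R) (g : {dot T for idfun}).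
Variables (o u : 4.-tuple T).
Hypotheses (ho : orthonormal_basis g o) (hu : orthonormal_basis g u).
Variables (F : tensor4 T) (hF : algebraic_curvature_tensor F).
Variable mu : 4.-tuple R.
Hypotheses (s0 : scal o F = 0)
  (de : diagonalized_by g (einstein_tensor g o F) u mu).
Notation W := (weyl g o F).

Lemma bilinear_frame (B : T -> T -> R) a :
  (forall y, scalar (fun x => B x y)) -> (forall x, scalar (B x)) ->
  (forall i j : 'I_4, B u`_i u`_j = a * (i == j)%:R) ->
  forall x y, B x y = a * g x y.
Proof.
move=> l1 l2 Bu x y; rewrite [in LHS](onb_expand x hu) (scalar_sum _ _ (l1 _)).
rewrite -[g x y](parseval _ _ hu) mulr_sumr; apply: eq_bigr => i _.
rewrite [in LHS](onb_expand y hu) (scalar_sum _ _ (l2 _)) (bigD1 i) //=.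
rewrite big1 ?addr0 => [|j /negPf ji]; last by rewrite Bu eq_sym ji !mulr0.
by rewrite Bu eqxx mulr1 (dotC g x) (dotC g y); ring.
Qed.

(** The products listed here are, up to constant factors, the off-diagonal
    components of the tensor that has to be a multiple of [g], and the differences
    between complementary pairs of its diagonal entries. *)
Lemma weakly_einsteinP : weakly_einstein g o F <->
  forall i j k l : 'I_4, uniq [:: i; j; k; l] ->
    (mu`_i - mu`_j) * W u`_i u`_k u`_i u`_l = 0 /\
    (mu`_i + mu`_j) * W u`_i u`_j u`_i u`_j = 0.
Proof.
have tab := curvature_square_table ho hu hF s0 de.
split=> [/(weakly_einstein_indep ho hu hF)[a Ha] i j k l un|H].
  have Ta x y : curvature_square u F x y = a * g x y := Ha x y.
  have [t1 t2] := tab _ _ _ _ un; move: t1 t2.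
  rewrite !Ta !(dot_onb hu) !eqxx !(distinct_neq un) /=; lra.
apply: (weakly_einstein_indep hu ho hF).
pose S := curvature_square u F.
exists (S u`_0 u`_0); apply: bilinear_frame => [y|x|i j].
- by do 3![apply: scalar_sumf => ?]; apply: scalar_mulr; apply: (act_linear1 hF).
- by do 3![apply: scalar_sumf => ?]; apply: scalar_mull; apply: (act_linear1 hF).
have [<-|ij] := eqVneq i j; last first.
  have [k [l un]] := complement_pair ij.
  by rewrite mulr0 -[LHS]/(S _ _) /S (tab _ _ _ _ un) -mulrA (H _ _ _ _ un).1 mulr0.
rewrite mulr1 -[LHS]/(S _ _).
have dS (p q r s : 'I_4) : uniq [:: p; q; r; s] ->
    S u`_p u`_p + S u`_q u`_q = S u`_r u`_r + S u`_s u`_s.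
  by move=> un; have [_] := tab _ _ _ _ un; rewrite -mulrA (H _ _ _ _ un).2 -/S; lra.
(* Equal sums over the three splittings of the four diagonal entries into two
   pairs force the entries to be equal. *)
have [->//|i0] := eqVneq i ord0; have [k [l un]] := complement_pair i0.
have d := distinct_neq un.
have := dS i ord0 k l; have := dS ord0 k i l; have := dS ord0 l i k.
by rewrite /= !inE !d => /(_ isT) + /(_ isT) + /(_ isT); rewrite /=; lra.
Qed.
End WeaklyEinstein.

(** * Components related by the index symmetries *)

Ltac related_skew :=
  first [ exact (alg_refl _) | exact (alg_skew12 (alg_refl _))
        | exact (alg_skew34 (alg_refl _))
        | exact (alg_skew12 (alg_skew34 (alg_refl _))) ].
Ltac related := first [ related_skew | apply alg_pair; related_skew ].

Lemma permuted_related (a b c d i j k l : 'I_4) :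
    i \in [:: a; b; c; d] -> j \in [:: a; b; c; d] ->
    k \in [:: a; b; c; d] -> l \in [:: a; b; c; d] -> uniq [:: i; j; k; l] ->
  [\/ algebraically_related (i, j, k, l) (a, b, c, d),
      algebraically_related (i, j, k, l) (a, c, d, b) |
      algebraically_related (i, j, k, l) (a, d, b, c)].
Proof.
rewrite !inE => /or4P[]/eqP-> /or4P[]/eqP-> /or4P[]/eqP-> /or4P[]/eqP->;
  rewrite /= !inE ?eqxx ?orbT ?andbF // => _;
  first [ constructor 1; related | constructor 2; related | constructor 3; related ].
Qed.

Lemma uniq_related (i j k l : 'I_4) : uniq [:: i; j; k; l] ->
  [\/ algebraically_related (i, j, k, l) (0, 1, 2, 3),
      algebraically_related (i, j, k, l) (0, 2, 3, 1) |
      algebraically_related (i, j, k, l) (0, 3, 1, 2)].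
Proof.
have I4 (m : 'I_4) : m \in [:: 0; 1; 2; 3] by case: m => [[|[|[|[|//]]]] ?].
exact: permuted_related.
Qed.

(** * The Weyl tensor in a magnetic frame *)

Section Magnetic.
Variables (R : realType) (T : vectType R) (g : {dot T for idfun}).
Variables (o u : 4.-tuple T).
Hypotheses (ho : orthonormal_basis g o) (hu : orthonormal_basis g u).
Variables (F : tensor4 T) (hF : algebraic_curvature_tensor F).
Notation W := (weyl g o F).
Let hW : algebraic_curvature_tensor W := weyl_act g o hF.

Lemma magnetic_repeated c2 c3 c4 (i j : 'I_4) x : magnetic g o u F c2 c3 c4 ->
  W u`_i x u`_i u`_j = 0.
Proof.
move=> [h01 h02 h03 h23 h31 h12].
have E a b c : (a < 4)%N -> (b < 4)%N -> (c < 4)%N -> a != b -> a != c ->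
    wedge g u`_b u`_c u`_a x = 0.
  move=> ha hb hc /negPf ab /negPf ac; rewrite /wedge !(dot_onb_nat hu) //.
  by rewrite !(eq_sym _ a) ab ac mul0r mulr0 subr0.
case: i => [[|[|[|[|//]]]] hi]; case: j => [[|[|[|[|//]]]] hj] /=;
  rewrite ?(act_diag2 _ _ _ hW) // ?(h01, h02, h03, h23, h31, h12) ?E ?mulr0 //;
  by rewrite (act_skew34 hW) ?(h01, h02, h03, h23, h31, h12) ?E ?mulr0 ?oppr0.
Qed.

Lemma magnetic_support c2 c3 c4 (i j k l : 'I_4) : magnetic g o u F c2 c3 c4 ->
  W u`_i u`_j u`_k u`_l != 0 -> uniq [:: i; j; k; l].
Proof.
move=> mg; apply: contraNT => nu; apply/eqP; move: nu.
have r1 := magnetic_repeated _ _ _ mg.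
have [-> _|ij] := eqVneq i j; first exact: act_diag1 hW.
have [-> _|kl] := eqVneq k l; first exact: act_diag2 hW.
have [-> _|ik] := eqVneq i k; first exact: r1.
have [-> _|jk] := eqVneq j k; first by rewrite (act_skew12 hW) r1 oppr0.
have [-> _|il] := eqVneq i l; first by rewrite (act_skew34 hW) r1 oppr0.
have [-> _|jl] := eqVneq j l.
  by rewrite (act_skew12 hW) (act_skew34 hW) r1 !oppr0.
by rewrite /= !inE !negb_or ij ik il jk jl kl.
Qed.

(** By tracelessness the components [W_abcd] without index 0 are, up to sign,
    electric ones, so once these vanish only the off-diagonal magnetic components
    are left to be killed; the second to seventh hypotheses do that. *)
Lemma magneticI :
    (forall x y, W u`_0 x u`_0 y = 0) ->
    W u`_0 u`_1 u`_3 u`_1 = 0 -> W u`_0 u`_1 u`_1 u`_2 = 0 ->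
    W u`_0 u`_2 u`_1 u`_2 = 0 -> W u`_0 u`_2 u`_2 u`_3 = 0 ->
    W u`_0 u`_3 u`_2 u`_3 = 0 -> W u`_0 u`_3 u`_3 u`_1 = 0 ->
  magnetic g o u F (W u`_0 u`_1 u`_2 u`_3) (W u`_0 u`_2 u`_3 u`_1)
    (W u`_0 u`_3 u`_1 u`_2).
Proof.
move=> W0 h12 h13 h23 h21 h31 h32.
have biv z w : bivector (fun x y => W x y z w).
  split=> [y|x|x y]; first exact: (act_linear1 hW).
    exact: (act_linear2 hW).
  exact: (act_skew12 hW).
pose i1 : 'I_4 := lift ord0 ord0; pose i2 : 'I_4 := lift ord0 (lift ord0 ord0).
have dual i j k l := weyl_complement_offdiag ho hu hF (i := i) (j := j) (k := k) (l := l).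
have comp i j k l := weyl_complement ho hu hF (i := i) (j := j) (k := k) (l := l).
have W23 : W u`_2 u`_3 u`_2 u`_3 = 0 by rewrite -(comp ord0 i1 i2 ord_max isT) W0.
have W31 : W u`_3 u`_1 u`_3 u`_1 = 0 by rewrite -(comp ord0 i2 ord_max i1 isT) W0.
have W12 : W u`_1 u`_2 u`_1 u`_2 = 0 by rewrite -(comp ord0 ord_max i1 i2 isT) W0.
have W1213 : W u`_1 u`_2 u`_1 u`_3 = 0.
  by apply: oppr_inj; rewrite -(dual ord0 i1 i2 ord_max isT) W0 oppr0.
have W2321 : W u`_2 u`_3 u`_2 u`_1 = 0.
  by apply: oppr_inj; rewrite -(dual ord0 i2 ord_max i1 isT) W0 oppr0.
have W3132 : W u`_3 u`_1 u`_3 u`_2 = 0.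
  by apply: oppr_inj; rewrite -(dual ord0 ord_max i1 i2 isT) W0 oppr0.
have sk12 := act_skew12 hW; have sk34 := act_skew34 hW; have pr := act_pair hW.
have Z3123 : W u`_3 u`_1 u`_2 u`_3 = 0 by rewrite sk34 W3132 oppr0.
have Z2312 : W u`_2 u`_3 u`_1 u`_2 = 0 by rewrite sk34 W2321 oppr0.
have Z1231 : W u`_1 u`_2 u`_3 u`_1 = 0 by rewrite sk34 W1213 oppr0.
have Z2331 : W u`_2 u`_3 u`_3 u`_1 = 0 by rewrite pr.
have Z1223 : W u`_1 u`_2 u`_2 u`_3 = 0 by rewrite pr.
have Z3112 : W u`_3 u`_1 u`_1 u`_2 = 0 by rewrite pr.
have zero := (h12, h13, h23, h21, h31, h32, W23, W31, W12,
  (Z3123, Z2312, Z1231, Z2331, Z1223, Z3112), (mul0r, add0r, addr0)).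
split=> x y; rewrite (bivector_wedge x y hu (biv _ _)) ?W0;
  by rewrite ?(pr u`_2 u`_3 u`_0) ?(pr u`_3 u`_1 u`_0) ?(pr u`_1 u`_2 u`_0) !zero.
Qed.

Lemma weyl_bianchi_magnetic :
  W u`_0 u`_1 u`_2 u`_3 + W u`_0 u`_2 u`_3 u`_1 + W u`_0 u`_3 u`_1 u`_2 = 0.
Proof.
have := act_bianchi hW u`_1 u`_2 u`_3 u`_0.
rewrite (act_pair hW u`_1 u`_2) (act_pair hW u`_2 u`_3) (act_pair hW u`_3 u`_1).
by rewrite (act_skew12 hW u`_3) (act_skew12 hW u`_1) (act_skew12 hW u`_2); lra.
Qed.
End Magnetic.

(** * Frames adapted to a symmetric bilinear form *)

Section EigenFrames.
Variables (R : realType) (T : vectType R) (g : {dot T for idfun}).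
Implicit Types (o u v : 4.-tuple T) (B : T -> T -> R) (mu : 4.-tuple R).

Lemma onb_permute u (s : 'S_4) : orthonormal_basis g u ->
  orthonormal_basis g [tuple u`_(s i) | i < 4].
Proof.
move=> hu; apply: (onb_of_dot hu) => i j.
by rewrite !nth_mktuple (dot_onb hu) (inj_eq perm_inj).
Qed.

Lemma volume_onb_neq0 o u : orthonormal_basis g o -> orthonormal_basis g u ->
  volume g o u`_0 u`_1 u`_2 u`_3 != 0.
Proof.
move=> ho hu; pose A := \matrix_(i < 4, j < 4) g u`_i o`_j.
have -> : volume g o u`_0 u`_1 u`_2 u`_3 = \det A.
  congr (\det _); apply/matrixP => i j; rewrite !mxE.
  by case: i => [[|[|[|[|//]]]] ?].
have AAT : A *m A^T = 1%:M.
  apply/matrixP => i j; rewrite !mxE -(dot_onb hu) -(parseval _ _ ho).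
  by apply: eq_bigr => k _; rewrite !mxE !(dotC g _ o`_k).
have := congr1 (fun M => \det M) AAT.
rewrite det_mulmx det_tr det1 => E; apply: contra_eq_neq E => ->.
by rewrite mul0r eq_sym oner_eq0.
Qed.

Lemma volumeZ1 o a x y z w :
  volume g o (a *: x) y z w = a * volume g o x y z w.
Proof.
have wZ b c : wedge g b c (a *: x) y = a * wedge g b c x y.
  exact: (functionalZ a x ((wedge_bilinear g b c).1 y)).
by rewrite !volumeE !wZ -!mulrA -!mulrDr.
Qed.

(** Only the first vector is touched because the magnetic form introduced below
    is even in it, and so stays diagonal. *)
Lemma positive_flip o u : orthonormal_basis g o -> orthonormal_basis g u ->
  exists (e : bool) (v : 4.-tuple T), positive_orthonormal_basis g o v /\
    v = [tuple (-1) ^+ e *: u`_0; u`_1; u`_2; u`_3].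
Proof.
move=> ho hu; pose e := volume g o u`_0 u`_1 u`_2 u`_3 < 0.
exists e; eexists; split; last reflexivity.
split.
  apply: (onb_of_dot hu) => -[[|[|[|[|//]]]] hi] [[|[|[|[|//]]]] hj] /=;
  rewrite ?dotZl ?dotZr !(dot_onb_nat hu) //= ?mulr0 //.
  by rewrite mulr1 -signr_addb addbb.
rewrite /= volumeZ1.
rewrite /e; have := volume_onb_neq0 ho hu; set V := volume _ _ _ _ _ _.
rewrite neq_lt; case: (V < 0) / ltP => [V0 _|_ /= V0]; last by rewrite mul1r.
by rewrite mulN1r oppr_gt0.
Qed.

Definition frame_mx B u : 'M[R]_4 := \matrix_(i, j) B u`_i u`_j.

Definition rotate (P : 'M[R]_4) u : 4.-tuple T :=
  [tuple \sum_(j < 4) P i j *: u`_j | i < 4].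

Lemma rotateE P u (i : 'I_4) : (rotate P u)`_i = \sum_(j < 4) P i j *: u`_j.
Proof. exact: nth_mktuple. Qed.

Lemma frame_mx_rotate B u P :
  (forall y, scalar (fun x => B x y)) -> (forall x, scalar (B x)) ->
  frame_mx B (rotate P u) = P *m frame_mx B u *m P^T.
Proof.
move=> l1 l2; apply/matrixP => i j; rewrite !mxE !rotateE.
rewrite (scalar_sum _ _ (l2 _)); apply: eq_bigr => k _.
rewrite (scalar_sum _ _ (l1 _)) mulrC !mxE; congr (_ * _).
by apply: eq_bigr => m _; rewrite !mxE.
Qed.

Lemma onb_rotate u P : orthonormal_basis g u -> P *m P^T = 1%:M ->
  orthonormal_basis g (rotate P u).
Proof.
move=> hu PP; apply: (onb_of_dot hu) => i j.
transitivity (frame_mx g (rotate P u) i j); first by rewrite mxE.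
rewrite (frame_mx_rotate _ _ (scalar_dotl g) (scalar_dotr g)).
have -> : frame_mx g u = 1%:M by apply/matrixP => k l; rewrite !mxE (dot_onb hu).
by rewrite mulmx1 PP mxE.
Qed.

Lemma diagonalized_of_diag B u : orthonormal_basis g u ->
  (forall x, scalar (B x)) -> is_diag_mx (frame_mx B u) ->
  diagonalized_by g B u [tuple B u`_i u`_i | i < 4].
Proof.
move=> hu l2 /is_diag_mxP d i x; rewrite nth_mktuple.
rewrite [in LHS](onb_expand x hu) (scalar_sum _ _ (l2 _)) (bigD1 i) //=.
rewrite big1 ?addr0 => [|j ji]; first by rewrite mulrC (dotC g x).
have := d i j; rewrite mxE => -> //; first by rewrite mulr0.
by rewrite eq_sym.
Qed.

Lemma diagonalized_flip B u mu a : (forall y, scalar (fun x => B x y)) ->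
  diagonalized_by g B u mu ->
  diagonalized_by g B [tuple a *: u`_0; u`_1; u`_2; u`_3] mu.
Proof.
move=> l1 du i x; have := du i x.
case: i => [[|[|[|[|//]]]] hi] //= dix.
by rewrite (functionalZ _ _ (l1 x)) dotZl dix mulrCA.
Qed.

Lemma double_eigenvalue B u mu (i j k l : 'I_4) :
    orthonormal_basis g u -> (forall y, scalar (fun x => B x y)) ->
    (forall x y, B x y = B y x) -> diagonalized_by g B u mu ->
    uniq [:: i; j; k; l] -> mu`_i = mu`_j -> mu`_i != mu`_k -> mu`_i != mu`_l ->
  eigenvalue_of_multiplicity g B mu`_i 2.
Proof.
move=> hu l1 sB dB un ij ik il; exists <<[:: u`_i; u`_j]>>%VS.
have d := distinct_neq un.
split; last first.
  have fr : free [:: u`_i; u`_j].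
    have nz (m : 'I_4) : u`_m != 0.
      apply/eqP => um0; have := dot_onb hu m m; rewrite eqxx um0.
      by rewrite (functional0 (scalar_dotr g _)) => /esym/eqP; rewrite oner_eq0.
    rewrite free_cons seq1_free nz andbT span_seq1; apply/vlineP => -[c E].
    have := dot_onb hu i i; rewrite eqxx {1}E dotZl.
    by rewrite (dot_onb hu) d mulr0 => /esym/eqP; rewrite oner_eq0.
  by move: fr; rewrite /free => /eqP.
move=> x; rewrite span_cons span_seq1; split.
  move=> /memv_addP[_ /vlineP[p ->] [_ /vlineP[q ->] ->]] y.
  rewrite (functionalD (l1 y)) (functionalD (scalar_dotl g y)).
  rewrite !(functionalZ _ _ (l1 y)) !dotZl.
  by rewrite !dB -ij; ring.
move=> Bx.
have coord0 (m : 'I_4) : mu`_i != mu`_m -> g x u`_m = 0.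
  move=> im; have := Bx u`_m; rewrite sB dB (dotC g _ x) => /eqP.
  by rewrite -subr_eq0 -mulrBl mulf_eq0 subr_eq0 eq_sym (negPf im) => /eqP.
rewrite (onb_expand x hu) (sum_distinct _ un) (coord0 k ik) (coord0 l il).
by rewrite !scale0r !addr0 memv_add // memvZ // memv_line.
Qed.

(** If [mu_i = mu_j], the remaining two eigenvalues are neither equal to each
    other and distinct from [mu_i] (two double eigenvalues) nor both equal to
    [mu_i] (then all vanish, having zero sum); so one of them is simple. *)
Lemma simple_eigenvalue B u mu :
    orthonormal_basis g u -> (forall y, scalar (fun x => B x y)) ->
    (forall x y, B x y = B y x) -> diagonalized_by g B u mu ->
    \sum_(i < 4) mu`_i = 0 -> ~ (forall x y, B x y = 0) ->
    ~ two_double_eigenvalues g B ->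
  exists i : 'I_4, forall j : 'I_4, j != i -> mu`_j != mu`_i.
Proof.
move=> hu l1 sB dB tr0 nz n2.
have pair (i j : 'I_4) : i != j -> mu`_i = mu`_j ->
    exists m : 'I_4, forall n : 'I_4, n != m -> mu`_n != mu`_m.
  move=> nij ij; have [k [l un]] := complement_pair nij.
  have un' : uniq [:: i; j; k; l] by rewrite (uniq_catC [:: i; j] [:: k; l]).
  have mem (n : 'I_4) : n \in [:: i; j; k; l].
    by rewrite (mem_distinct un') mem_enum.
  have [kl|kl] := eqVneq mu`_k mu`_l.
    exfalso.
    have [ik|ik] := eqVneq mu`_i mu`_k.
      apply: nz => x y; rewrite (onb_expand x hu) (scalar_sum _ _ (l1 y)).
      rewrite big1 // => m _; rewrite dB.
      suff -> : mu`_m = 0 by rewrite mul0r mulr0.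
      have := mem m; rewrite (sum_distinct _ un') -kl -ik -ij in tr0 *.
      by rewrite !inE => /or4P[]/eqP->; lra.
    apply: n2; exists mu`_i, mu`_k; split=> //; split.
      by apply: (double_eigenvalue hu l1 sB dB un'); rewrite // -kl.
    by apply: (double_eigenvalue hu l1 sB dB un); rewrite // -?ij eq_sym.
  have [ik|ik] := eqVneq mu`_i mu`_k.
    exists l => n; have := mem n; rewrite !inE => /or4P[]/eqP-> nl;
      rewrite -?ij ?ik //; by rewrite eqxx in nl.
  exists k => n; have := mem n; rewrite !inE => /or4P[]/eqP-> nl;
    rewrite -?ij //; first [by rewrite eqxx in nl | by rewrite eq_sym].
case: (boolP [forall j : 'I_4, (j != ord0) ==> (mu`_j != mu`_(@ord0 3))]).
  by move=> /forallP h; exists ord0 => j j0; apply: (implyP (h j)).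
rewrite negb_forall => /existsP[j]; rewrite negb_imply negbK => /andP[j0 /eqP E].
exact: pair j0 E.
Qed.

End EigenFrames.

(** * Vanishing of the electric part *)

Section Normalization.
Variables (R : realType) (T : vectType R) (g : {dot T for idfun}).
Variables (o : 4.-tuple T) (ho : orthonormal_basis g o).
Variables (F : tensor4 T) (hF : algebraic_curvature_tensor F).
Hypothesis s0 : scal o F = 0.
Notation W := (weyl g o F).
Notation e := (einstein_tensor g o F).
Let hW : algebraic_curvature_tensor W := weyl_act g o hF.

Lemma einstein_tensor_sym x y : e x y = e y x.
Proof. by rewrite /einstein_tensor (ricci_sym o hF) dotC. Qed.

Lemma scalar_einstein_tensor x : scalar (e x).
Proof.
apply: scalar_add; first exact: scalar_ricci.
by apply/scalar_opp/scalar_mulr/scalar_mull/scalar_dotr.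
Qed.

Lemma scalar_einstein_tensorl y : scalar (e^~ y).
Proof.
by move=> a x x' /=; rewrite einstein_tensor_sym scalar_einstein_tensor
  !(einstein_tensor_sym y).
Qed.

Lemma adapted_frame : ~ einstein g o F -> ~ two_double_eigenvalues g e ->
  exists (u : 4.-tuple T) (mu : 4.-tuple R),
    [/\ positive_orthonormal_basis g o u, diagonalized_by g e u mu &
        forall j : 'I_4, j != ord0 -> mu`_j != mu`_(@ord0 3)].
Proof.
move=> nE n2.
have sE : (frame_mx e o)^T = frame_mx e o.
  by apply/matrixP => i j; rewrite !mxE einstein_tensor_sym.
have [P [PP dP _]] := codiagonalization sE sE erefl.
have hv := onb_rotate ho PP; move: hv dP.
rewrite -(frame_mx_rotate _ _ scalar_einstein_tensorl scalar_einstein_tensor).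
move: (rotate P o) => v hv /(diagonalized_of_diag hv scalar_einstein_tensor).
move: (mktuple _) => mu dv.
have [|//|//|i simple] :=
  simple_eigenvalue hv scalar_einstein_tensorl einstein_tensor_sym dv.
  have un : uniq [:: ord0; lift ord0 ord0; lift ord0 (lift ord0 ord0); @ord_max 3] by [].
  by rewrite (sum_distinct _ un) (mu_sum ho hv hF s0 dv un).
have hp := onb_permute (tperm ord0 i) hv.
have dp : diagonalized_by g e [tuple v`_(tperm ord0 i k) | k < 4]
    [tuple mu`_(tperm ord0 i k) | k < 4].
  by move=> m y; rewrite !nth_mktuple dv.
have [f [w [pw wE]]] := positive_flip ho hp.
exists w, [tuple mu`_(tperm ord0 i k) | k < 4]; split=> // [|k k0].
  by rewrite wE; exact: (diagonalized_flip ((-1) ^+ f) scalar_einstein_tensorl dp).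
rewrite !nth_mktuple tpermL simple //.
by rewrite -{2}(tpermL ord0 i) (inj_eq perm_inj).
Qed.

Section WeaklyEinstein.
Hypothesis we : weakly_einstein g o F.

(** Off the diagonal, [W_0k0l] is killed by [mu_0 - mu_j], where [j] is the
    fourth index, and this is nonzero.  On the diagonal, [W_0k0k] is killed by
    [mu_0 + mu_k]; two of these factors cannot both vanish, because the
    remaining eigenvalue would be [mu_0], so that two of the [W_0k0k] are zero,
    and so is the third, by tracelessness. *)
Lemma electric_part_eq0 u mu x y : orthonormal_basis g u ->
    diagonalized_by g e u mu ->
    (forall j : 'I_4, j != ord0 -> mu`_j != mu`_(@ord0 3)) ->
  W u`_0 x u`_0 y = 0.
Proof.
move=> hu du simple; have weP := (weakly_einsteinP ho hu hF s0 du).1 we.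
transitivity (0 * g x y); last by rewrite mul0r.
pose B x y := W u`_0 x u`_0 y.
apply: (bilinear_frame hu (B := B)) => [z|z|k l].
- exact: (act_linear2 hW).
- exact: (act_linear4 hW).
rewrite mul0r /B.
have [->|k0] := eqVneq k ord0; first exact: act_diag1 hW.
have [->|l0] := eqVneq l ord0; first exact: act_diag2 hW.
have [<-|kl] := eqVneq k l; last first.
  have un3 : uniq [:: ord0; k; l] by rewrite /= !inE negb_or !(eq_sym ord0) k0 l0 kl.
  have [j un] := complement_point un3; have [/eqP + _] := weP _ _ _ _ un.
  rewrite mulf_eq0 subr_eq0 eq_sym (negPf (simple j _)) => [/eqP//|].
  by rewrite (distinct_neq un).
have [p [q un]] := complement_pair k0; have d := distinct_neq un.
have un1 : uniq [:: ord0; k; p; q] by rewrite /= !inE !d.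
have un2 : uniq [:: ord0; p; k; q] by rewrite /= !inE !d.
have un3 : uniq [:: ord0; q; k; p] by rewrite /= !inE !d.
have tr := weyl_trace_distinct ho hu hF u`_0 u`_0 un1.
rewrite (act_diag1 _ _ _ hW) add0r in tr.
have mu0 := mu_sum ho hu hF s0 du un1.
have [_ /eqP] := weP _ _ _ _ un1; have [_ /eqP] := weP _ _ _ _ un2.
have [_ /eqP] := weP _ _ _ _ un3; rewrite !mulf_eq0.
have := simple q _; have := simple p _; have := simple k k0; rewrite !d.
move=> mk /(_ isT) mp /(_ isT) mq.
move=> /orP[/eqP qq|/eqP qq] /orP[/eqP pp|/eqP pp] /orP[/eqP kk|/eqP kk] //.
- by case/eqP: mk; lra.
- by case/eqP: mk; lra.
- by case/eqP: mp; lra.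
- by move: tr; rewrite qq pp !addr0.
Qed.
End WeaklyEinstein.
End Normalization.

(** * The magnetic part *)

Section MagneticForm.
Variables (R : realType) (T : vectType R) (g : {dot T for idfun}).
Variables (o : 4.-tuple T) (ho : orthonormal_basis g o).
Variables (F : tensor4 T) (hF : algebraic_curvature_tensor F).
Notation W := (weyl g o F).
Notation e := (einstein_tensor g o F).
Let hW : algebraic_curvature_tensor W := weyl_act g o hF.

(** Written through the Hodge operator, the magnetic part of [W] with respect
    to [t] depends on no frame, and being even in [t] it survives the change of
    sign that restores the orientation of a frame. *)
Definition magnetic_form t x y : R := hodge g o (W t x) t y.

Lemma magnetic_form_scale a t x y :
  magnetic_form (a *: t) x y = a ^+ 2 * magnetic_form t x y.
Proof.
rewrite /magnetic_form /hodge mulrA mulr_sumr; congr (_ / _).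
apply: eq_bigr => k _; rewrite mulr_sumr; apply: eq_bigr => l _.
by rewrite volumeZ1 (functionalZ a t (act_linear1 hW x o`_k o`_l)); ring.
Qed.

Lemma magnetic_form_frame u x y : positive_orthonormal_basis g o u ->
  magnetic_form u`_0 x y = W u`_0 x u`_2 u`_3 * g u`_1 y
    + W u`_0 x u`_3 u`_1 * g u`_2 y + W u`_0 x u`_1 u`_2 * g u`_3 y.
Proof.
move=> pu; have hu := pu.1.
have hb : bivector (W u`_0 x).
  split=> [z|z|z z']; first exact: (act_linear3 hW).
    exact: (act_linear4 hW).
  exact: (act_skew34 hW).
rewrite /magnetic_form (hodge_frame ho pu _ _ hb) /wedge !(dot_onb_nat hu) //=.
by ring.
Qed.

Lemma magnetic_form_bilinear u : positive_orthonormal_basis g o u ->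
  (forall y, scalar ((magnetic_form u`_0)^~ y)) /\
  (forall x, scalar (magnetic_form u`_0 x)).
Proof.
move=> pu; split=> z a x y /=; rewrite !(magnetic_form_frame _ _ pu).
  by rewrite !(act_linear2 hW); ring.
by rewrite !(scalar_dotr g); ring.
Qed.

Section Normal.
Variables (u : 4.-tuple T) (mu : 4.-tuple R).
Hypotheses (pu : positive_orthonormal_basis g o u) (s0 : scal o F = 0)
  (we : weakly_einstein g o F) (du : diagonalized_by g e u mu).
Let hu : orthonormal_basis g u := pu.1.

(** For [(a, b, c)] a cyclic permutation of 1, 2, 3, these are the symmetry
    of the magnetic form and the vanishing of its commutator with [e], read on
    the pair [a, b]. *)
Lemma magnetic_form_block_cycle (a b c : 'I_4) : uniq [:: a; b; ord0; c] ->
  W u`_0 u`_a u`_c u`_a = W u`_0 u`_b u`_b u`_c /\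
  (mu`_a - mu`_b) * W u`_0 u`_a u`_c u`_a = 0.
Proof.
move=> un; have [E _] := (weakly_einsteinP ho hu hF s0 du).1 we _ _ _ _ un.
have dl := weyl_complement_offdiag ho hu hF un.
rewrite (act_skew12 hW u`_0 u`_a) (act_skew34 hW _ _ u`_c) opprK; split=> //.
by rewrite dl (act_skew12 hW u`_0 u`_b).
Qed.

Definition spatial_mx (B : T -> T -> R) (v : 4.-tuple T) : 'M[R]_3 :=
  \matrix_(i, j) B v`_i.+1 v`_j.+1.

Lemma frame_mx_spatial (B : T -> T -> R) (v : 4.-tuple T) :
  (forall j : 'I_3, B v`_0 v`_j.+1 = 0) -> (forall j : 'I_3, B v`_j.+1 v`_0 = 0) ->
  frame_mx B v = block_mx (B v`_0 v`_0)%:M 0 0 (spatial_mx B v) :> 'M_(1 + 3).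
Proof.
move=> Br Bl; apply/matrixP => i j; rewrite /block_mx !mxE.
by case: splitP => i' ->; rewrite !mxE; case: splitP => j' ->;
  rewrite ?ord1 !mxE ?eqxx ?mulr1n ?(Br j') ?(Bl i').
Qed.

Lemma spatial_magnetic_sym : (spatial_mx (magnetic_form u`_0) u)^T =
  spatial_mx (magnetic_form u`_0) u.
Proof.
pose i1 : 'I_4 := lift ord0 ord0; pose i2 : 'I_4 := lift ord0 (lift ord0 ord0).
have [c12 _] := magnetic_form_block_cycle (a := i1) (b := i2) (c := ord_max) isT.
have [c23 _] := magnetic_form_block_cycle (a := i2) (b := ord_max) (c := i1) isT.
have [c31 _] := magnetic_form_block_cycle (a := ord_max) (b := i1) (c := i2) isT.
apply/matrixP => i j; rewrite !mxE !(magnetic_form_frame _ _ pu).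
move: c12 c23 c31; rewrite /i1 /i2 /= => c12 c23 c31.
by case: i => [[|[|[|//]]] hi]; case: j => [[|[|[|//]]] hj] /=;
  rewrite !(dot_onb_nat hu) //= !(mulr0, mulr1, add0r, addr0).
Qed.

Lemma spatial_magnetic_comm :
  spatial_mx (magnetic_form u`_0) u *m spatial_mx e u =
  spatial_mx e u *m spatial_mx (magnetic_form u`_0) u.
Proof.
pose i1 : 'I_4 := lift ord0 ord0; pose i2 : 'I_4 := lift ord0 (lift ord0 ord0).
have [c12 d12] := magnetic_form_block_cycle (a := i1) (b := i2) (c := ord_max) isT.
have [c23 d23] := magnetic_form_block_cycle (a := i2) (b := ord_max) (c := i1) isT.
have [c31 d31] := magnetic_form_block_cycle (a := ord_max) (b := i1) (c := i2) isT.
have -> : spatial_mx e u = diag_mx (\row_j mu`_j.+1).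
  apply/matrixP => i j; have duij : e u`_i.+1 u`_j.+1 =
    mu`_i.+1 * g u`_i.+1 u`_j.+1 := du (lift ord0 i) u`_j.+1.
  have gij : g u`_i.+1 u`_j.+1 = (lift ord0 i == lift ord0 j)%:R :=
    dot_onb hu (lift ord0 i) (lift ord0 j).
  rewrite !mxE duij gij (inj_eq lift_inj) mulr_natr.
  by have [->|] := eqVneq i j.
apply/matrixP => i j; rewrite mul_mx_diag mul_diag_mx !mxE.
rewrite !(magnetic_form_frame _ _ pu).
move: c12 d12 c23 d23 c31 d31; rewrite /i1 /i2 /= => c12 d12 c23 d23 c31 d31.
by case: i => [[|[|[|//]]] hi]; case: j => [[|[|[|//]]] hj] /=;
  rewrite !(dot_onb_nat hu) //= !(mulr0, mulr1, add0r, addr0) -?c12 -?c23 -?c31; lra.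
Qed.

End Normal.
End MagneticForm.

(** * The normal form of weakly Einstein curvature tensors *)

Lemma rotate_lift0 (R : realType) (T : vectType R) (Q : 'M[R]_3) (u : 4.-tuple T) :
  (rotate (lift0_mx Q) u)`_0 = u`_0.
Proof.
have E0 : @ord0 3 = lshift 3 ord0 :> 'I_(1 + 3) by apply: val_inj.
have P0 (j : 'I_(1 + 3)) : lift0_mx Q (@ord0 3) j = (j == @ord0 3)%:R.
  rewrite E0 /lift0_mx; case: (split_ordP j) => k ->.
    by rewrite block_mxEul mxE !ord1 eqxx.
  by rewrite block_mxEur mxE.
rewrite (rotateE (lift0_mx Q) u ord0) (bigD1 (@ord0 3)) //= big1 ?addr0 => [|j j0].
  by rewrite P0 scale1r.
by rewrite P0 (negPf j0) scale0r.
Qed.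

(** Start from a frame diagonalizing [e] with [mu_0] simple: the electric part
    of [W] then vanishes.  On the orthogonal complement of [u_0] the magnetic form
    is symmetric and commutes with [e], so a rotation of [u_1, u_2, u_3]
    diagonalizes both, and the resulting frame, oriented by the sign of its
    first vector, is the required one. *)
Lemma weakly_einstein_normal_form (R : realType) (T : vectType R)
    (g : {dot T for idfun}) (o : 4.-tuple T) (F : tensor4 T) :
    orthonormal_basis g o -> algebraic_curvature_tensor F ->
    ~ einstein g o F -> weakly_einstein g o F -> scal o F = 0 ->
    ~ two_double_eigenvalues g (einstein_tensor g o F) ->
  exists (u : 4.-tuple T) (mu1 mu2 mu3 mu4 c2 c3 c4 : R),
    [/\ positive_orthonormal_basis g o u,
        mu1 + mu2 + mu3 + mu4 = 0, c2 + c3 + c4 = 0 &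
        has_spectral_form g o F u mu1 mu2 mu3 mu4 c2 c3 c4].
Proof.
move=> ho hF nE we s0 n2.
have hW := weyl_act g o hF.
have [u [mu [pu du simple]]] := adapted_frame ho hF s0 nE n2.
have hu := pu.1.
pose e := einstein_tensor g o F; pose h := magnetic_form g o F u`_0.
have [hl hr] := magnetic_form_bilinear ho hF pu.
have el := scalar_einstein_tensorl g o hF; have er := scalar_einstein_tensor g o hF.
have eS : (spatial_mx e u)^T = spatial_mx e u.
  by apply/matrixP => i j; rewrite !mxE /e einstein_tensor_sym.
have hS := spatial_magnetic_sym ho hF pu s0 we du.
have [Q [QQ dh de]] := codiagonalization hS eS
  (spatial_magnetic_comm ho hF pu s0 we du).
pose P : 'M[R]_4 := lift0_mx Q; pose v := rotate P u.
have hv : orthonormal_basis g v := onb_rotate hu (lift0_mx_orthogonal QQ).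
have v0 : v`_0 = u`_0 := rotate_lift0 Q u.
have e0 (j : 'I_3) : e u`_0 u`_j.+1 = 0.
  have := du ord0 u`_j.+1; rewrite [X in _ * X](dot_onb hu ord0 (lift ord0 j)).
  by rewrite mulr0.
have h0 (j : 'I_3) : h u`_0 u`_j.+1 = 0.
  by rewrite /h (magnetic_form_frame ho hF _ _ pu) !(act_diag1 _ _ _ hW) !mul0r !addr0.
have h0r (j : 'I_3) : h u`_j.+1 u`_0 = 0.
  rewrite /h (magnetic_form_frame ho hF _ _ pu) !(dot_onb_nat hu) //=.
  by rewrite !mulr0 !addr0.
have dev : is_diag_mx (frame_mx e v).
  rewrite (frame_mx_rotate _ _ el er) frame_mx_spatial // => [|j].
    exact: lift0_mx_diag.
  by rewrite /e einstein_tensor_sym // e0.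
have dhv : is_diag_mx (frame_mx h v).
  rewrite (frame_mx_rotate _ _ hl hr) frame_mx_spatial //.
  exact: lift0_mx_diag.
have hv0 (a b : 'I_4) : a != b -> h v`_a v`_b = 0.
  by move=> ab; have /is_diag_mxP/(_ a b ab) := dhv; rewrite mxE.
have [f [w [pw wE]]] := positive_flip ho hv; have hw := pw.1.
have [nu dw] : exists nu, diagonalized_by g e w nu.
  have dv := diagonalized_of_diag hv er dev.
  by eexists; rewrite wE; exact: (diagonalized_flip ((-1) ^+ f) el dv).
have electric x y : weyl g o F w`_0 x w`_0 y = 0.
  have E0 := electric_part_eq0 ho hF s0 we _ _ hu du simple.
  rewrite wE /= v0 (functionalZ _ _ (act_linear1 hW _ _ _)).
  by rewrite (functionalZ _ _ (act_linear3 hW _ _ _)) E0 !mulr0.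
have hw0 x y : magnetic_form g o F w`_0 x y = h x y.
  by rewrite wE /= v0 magnetic_form_scale // sqrr_sign mul1r.
pose i1 : 'I_4 := lift ord0 ord0; pose i2 : 'I_4 := lift ord0 (lift ord0 ord0).
have wm x y : h x y = weyl g o F w`_0 x w`_2 w`_3 * g w`_1 y
    + weyl g o F w`_0 x w`_3 w`_1 * g w`_2 y + weyl g o F w`_0 x w`_1 w`_2 * g w`_3 y.
  by rewrite -hw0 (magnetic_form_frame ho hF _ _ pw).
have w1 : w`_1 = v`_1 by rewrite wE.
have w2 : w`_2 = v`_2 by rewrite wE.
have w3 : w`_3 = v`_3 by rewrite wE.
have z a b : (0 < a < 4)%N -> (0 < b < 4)%N -> a != b -> h w`_a w`_b = 0.
  case: a => [|[|[|[|//]]]] //; case: b => [|[|[|[|//]]]] // _ _ _;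
    rewrite ?w1 ?w2 ?w3.
  - exact: (hv0 i1 i2).
  - exact: (hv0 i1 ord_max).
  - exact: (hv0 i2 i1).
  - exact: (hv0 i2 ord_max).
  - exact: (hv0 ord_max i1).
  - exact: (hv0 ord_max i2).
have mg : magnetic g o w F (weyl g o F w`_0 w`_1 w`_2 w`_3)
    (weyl g o F w`_0 w`_2 w`_3 w`_1) (weyl g o F w`_0 w`_3 w`_1 w`_2).
  have simp := (@mulr0 R, @mulr1 R, @addr0 R, @add0r R).
  apply: (magneticI ho hw hF electric).
  - by have := z 1%N 2%N isT isT isT; rewrite wm !(dot_onb_nat hw) //= !simp.
  - by have := z 1%N 3%N isT isT isT; rewrite wm !(dot_onb_nat hw) //= !simp.
  - by have := z 2%N 3%N isT isT isT; rewrite wm !(dot_onb_nat hw) //= !simp.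
  - by have := z 2%N 1%N isT isT isT; rewrite wm !(dot_onb_nat hw) //= !simp.
  - by have := z 3%N 1%N isT isT isT; rewrite wm !(dot_onb_nat hw) //= !simp.
  - by have := z 3%N 2%N isT isT isT; rewrite wm !(dot_onb_nat hw) //= !simp.
exists w, nu`_0, nu`_1, nu`_2, nu`_3, (weyl g o F w`_0 w`_1 w`_2 w`_3),
  (weyl g o F w`_0 w`_2 w`_3 w`_1), (weyl g o F w`_0 w`_3 w`_1 w`_2).
split=> //; last split.
- exact: (mu_sum ho hw hF s0 dw (i := ord0) (j := i1) (k := i2) (l := ord_max) isT).
- exact: weyl_bianchi_magnetic.
- by move=> i x; have := dw i x; case: i => [[|[|[|[|//]]]] hi].
- exact/(magneticP ho pw hF).
Qed.

Theorem theorem1p3 (R : realType) (T : vectType R) (g : {dot T for idfun})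
    (o : 4.-tuple T) (ho : orthonormal_basis g o) :
  (forall (u : 4.-tuple T) (mu1 mu2 mu3 mu4 c2 c3 c4 : R) (F : tensor4 T),
     positive_orthonormal_basis g o u ->
     mu1 + mu2 + mu3 + mu4 = 0 -> c2 + c3 + c4 = 0 ->
     algebraic_curvature_tensor F -> scal o F = 0 ->
     has_spectral_form g o F u mu1 mu2 mu3 mu4 c2 c3 c4 ->
     let W (i j k l : 'I_4) := weyl g o F u`_i u`_j u`_k u`_l in
     weakly_einstein g o F /\
     (forall i j k l : 'I_4, W i j k l != 0 ->
        [\/ algebraically_related (i, j, k, l) (0, 1, 2, 3),
            algebraically_related (i, j, k, l) (0, 2, 3, 1) |
            algebraically_related (i, j, k, l) (0, 3, 1, 2)]) /\
     (W 0 1 2 3, W 0 2 3 1, W 0 3 1 2) = (c2, c3, c4)) /\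
  (forall F : tensor4 T,
     algebraic_curvature_tensor F -> ~ einstein g o F ->
     weakly_einstein g o F -> scal o F = 0 ->
     ~ two_double_eigenvalues g (einstein_tensor g o F) ->
     exists (u : 4.-tuple T) (mu1 mu2 mu3 mu4 c2 c3 c4 : R),
       [/\ positive_orthonormal_basis g o u,
           mu1 + mu2 + mu3 + mu4 = 0, c2 + c3 + c4 = 0 &
           has_spectral_form g o F u mu1 mu2 mu3 mu4 c2 c3 c4]).
Proof.
split=> [u mu1 mu2 mu3 mu4 c2 c3 c4 F pu _ _ hF s0 [du wd] W|F hF nE we s0 n2].
  have hu := pu.1; have mg := (magneticP ho pu hF c2 c3 c4).1 wd.
  split; last split.
  - apply/(weakly_einsteinP ho hu hF s0 du) => i j k l _.
    by rewrite !(magnetic_repeated hu hF _ _ _ mg) !mulr0.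
  - by move=> i j k l /(magnetic_support hu hF mg)/uniq_related.
  - have [_ _ _ W23 W31 W12] := mg.
    rewrite /W /= W23 W31 W12 !(wedge_onb pu) //=.
    by rewrite !(mulr0, mulr1, subr0).
exact: (weakly_einstein_normal_form ho hF nE we s0 n2).
Qed.
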